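(* Let $f=h+\overline{g}\in\mathcal{B}_{H}(\lambda)$ with $b_1=g'(0)$. If $\lambda>1$, then $f$, $h$ and $g$ satisfy the same growth condition: each of $f(z)$, $h(z)$, $g(z)$ is $$O\big((1-|z|)^{\frac{1-\lambda}{2}}\big)\quad\text{as }|z|\rightarrow 1.$$ If $\lambda<1$, then $|f|$, $|h|$ and $|g|$ are bounded in $\mathbb{D}$, respectively, by $$(1+|b_1|)H_{\frac{\lambda+1}{2}}(1),\quad (1-|b_1|)H_{\frac{\lambda-1}{2},\frac{\lambda+1}{2}}(1)+|b_1|H_{\frac{\lambda+1}{2}}(1),\quad H_{\frac{\lambda+1}{2}}(1)-(1-|b_1|)H_{\frac{\lambda-1}{2},\frac{\lambda+1}{2}}(1).$$ For all $\lambda>0$, the image $h(\mathbb{D})$ contains the disk $\{w:|w|<-\sqrt{1-|b_1|^2}\,H_{\frac{\lambda}{2}}(-1)\}$. If $f\in\mathcal{B}_{H}(\lambda)\cap\mathcal{S}_{H}$, then the image $f(\mathbb{D})$ contains the disk $\{w:|w|<-(1-|b_1|)H_{\frac{\lambda+1}{2}}(-1)\}$.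
   Context: $\mathbb{D}=\{z\in\mathbb{C}:|z|<1\}$. A harmonic mapping in $\mathbb{D}$ is written $f=h+\overline{g}$ with $h,g$ analytic in $\mathbb{D}$, $g(0)=0$; it is sense-preserving if $|h'|^2-|g'|^2>0$ in $\mathbb{D}$. Its pre-Schwarzian derivative and norm are $$P_f=\frac{h''\overline{h'}-g''\overline{g'}}{|h'|^2-|g'|^2},\qquad \|P_f\|=\sup_{z\in\mathbb{D}}(1-|z|^2)|P_f(z)|.$$ $\mathcal{H}$ is the set of sense-preserving harmonic mappings $f=h+\overline g$ in $\mathbb{D}$ with $h(0)=h'(0)-1=g(0)=0$; $\mathcal{S}_H$ is the set of univalent $f\in\mathcal{H}$; for $\lambda\ge0$, $\mathcal{B}_H(\lambda)=\{f\in\mathcal{H}:\|P_f\|\le\lambda\}$. For $a,b\in\mathbb{R}$, $H_{a,b}(z)=\int_0^z\frac{(1+t)^a}{(1-t)^b}\,dt$ and $H_a=H_{a,a}$; the values at $z=\pm1$ are the (finite) values of the corresponding integrals from $0$ to $\pm1$. *)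

(* Defs.v *)
From Stdlib Require Export Reals.
From Coquelicot Require Export Coquelicot.

Open Scope R_scope.

Definition unit_disk (z : C) : Prop := Cmod z < 1.

Definition analytic_at (F : C -> C) (z0 : C) : Prop :=
  exists (a : nat -> C) (r : R), 0 < r /\
    forall z : C, Cmod (z - z0) < r -> is_pseries a (z - z0)%C (F z).

Definition analytic_on_disk (F : C -> C) : Prop :=
  forall z : C, unit_disk z -> analytic_at F z.

(* A harmonic mapping of the disk is carried together with its canonical
   decomposition, which is unique on the disk because of [antihol_part_0].
   All functions are total on C; only their values on the disk matter. *)
Record harmonic_mapping : Type := HarmonicMapping {
  hol_part : C -> C;
  antihol_part : C -> C;
  hol_part_analytic : analytic_on_disk hol_part;
  antihol_part_analytic : analytic_on_disk antihol_part;
  antihol_part_0 : antihol_part 0 = 0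
}.

Definition harmonic_fun (f : harmonic_mapping) (z : C) : C :=
  (hol_part f z + Cconj (antihol_part f z))%C.

Coercion harmonic_fun : harmonic_mapping >-> Funclass.

Definition jacobian (f : harmonic_mapping) (z : C) : R :=
  Cmod (C_derive (hol_part f) z) ^ 2 - Cmod (C_derive (antihol_part f) z) ^ 2.

Definition sense_preserving (f : harmonic_mapping) : Prop :=
  forall z : C, unit_disk z -> jacobian f z > 0.

Definition preschwarzian (f : harmonic_mapping) (z : C) : C :=
  let h := hol_part f in
  let g := antihol_part f in
  ((C_derive (C_derive h) z * Cconj (C_derive h z)
    - C_derive (C_derive g) z * Cconj (C_derive g z))
   / RtoC (jacobian f z))%C.

Definition preschwarzian_norm (f : harmonic_mapping) : Rbar :=
  Lub_Rbar (fun x : R => exists z : C,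
    unit_disk z /\ x = (1 - Cmod z ^ 2) * Cmod (preschwarzian f z)).

Definition class_H (f : harmonic_mapping) : Prop :=
  sense_preserving f /\
  hol_part f 0 = 0 /\ C_derive (hol_part f) 0 = 1 /\ antihol_part f 0 = 0.

Definition univalent (f : C -> C) : Prop :=
  forall z w : C, unit_disk z -> unit_disk w -> f z = f w -> z = w.

Definition class_SH (f : harmonic_mapping) : Prop :=
  class_H f /\ univalent f.

Definition class_BH (lam : R) (f : harmonic_mapping) : Prop :=
  class_H f /\ Rbar_le (preschwarzian_norm f) lam.

Definition H_integrand (a b t : R) : R := Rpower (1 + t) a / Rpower (1 - t) b.

(* H_{a,b}(1) and H_{a,b}(-1), as improper Riemann integrals from 0.  The
   one-sided limits keep [Rpower] away from base 0, where its value is 1. *)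
Definition H_at_1 (a b : R) : R :=
  RInt_gen (H_integrand a b) (at_point 0) (at_left 1).

Definition H_at_m1 (a b : R) : R :=
  RInt_gen (H_integrand a b) (at_point 0) (at_right (-1)).

(* F(z) = O(phi(|z|)) as |z| -> 1 within the disk. *)
Definition bigO_at_circle (F : C -> C) (phi : R -> R) : Prop :=
  exists M r : R, r < 1 /\
    forall z : C, r < Cmod z < 1 -> Cmod (F z) <= M * phi (Cmod z).

Definition image_contains_disk (F : C -> C) (rho : R) : Prop :=
  forall w : C, Cmod w < rho -> exists z : C, unit_disk z /\ F z = w.

(* Main.v *)
Require Import Defs.
From Stdlib Require Import Reals Lra Lia Classical ClassicalEpsilon.
From Coquelicot Require Import Coquelicot.

Open Scope R_scope.

(** Write [b = |g'(0)|], [r = |z|], and let [omega = g' / h'] be the dilatation.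

    The pre-Schwarzian derivative is the logarithmic [z]-derivative of the
    Jacobian [J = |h'|^2 - |g'|^2], so along a radius the bound on its norm reads
    [|d/dr ln J| <= 2 lam / (1 - r^2)]; integrating, [J (z)] lies between
    [(1 - b^2) ((1 - r) / (1 + r))^lam] and [(1 - b^2) ((1 + r) / (1 - r))^lam]
    ([jacobian_bounds]).  On the other hand [|omega| < 1], and the Schwarz-Pick
    lemma gives [|omega (z)| <= (b + r) / (1 + b r)] ([dilatation_bound]).  Since
    [J = |h'|^2 (1 - |omega|^2)], these two facts bound [|h'|], [|g'|],
    [|h'| + |g'|] from above and [|h'|], [|h'| - |g'|] from below by those
    combinations of integrands of the functions [H_{a,b}] which occur in the theorem
    ([hol_derive_upper] to [derive_diff_lower]).

    The upper bounds are integrated along radii ([growth]); this gives both the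
    boundedness for [lam < 1] and the order of growth for [lam > 1].

    The two covering statements are instances of one fact ([harmonic_covering]):
    if [|A'| - |B'| >= p (|z|) > 0] and [P] is the primitive of [p] vanishing at
    [0], then [F = A + conj B] covers the disk of radius [P rho] for each [rho < 1].  Instead of
    lifting a segment, one minimises [|F z - w| + k P (|z|)] over [|z| <= rho] for
    some [k < 1] with [|w| < k P rho].  The value at [0] shows that the minimum
    is not on the boundary; and at an interior point with [F z <> w], moving in
    the direction that the differential sends to [w - F z] lowers the first term
    at a rate that the second one cannot compensate.  Hence a minimiser is a
    preimage of [w].  Only the differential of the mapping at each point enters, so
    that the argument applies to [h] and to [f] alike.

    The complex analysis behind this is developed from power series through
    iterated difference quotients ([expandable]), a notion that is stable under
    products and inverses without any manipulation of coefficients, and that is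
    enough for the maximum principle ([no_local_max]) and hence for the Schwarz
    lemma. *)

(** * Extrema on closed disks of the complex plane *)

Notation CU := (AbsRing_UniformSpace C_AbsRing).

(** The Bolzano-Weierstrass theorem is applied to the real parts, and then to the
    imaginary parts along a subsequence. *)
Lemma seq_C_cluster (u : nat -> C) (B : R) :
  (forall n, Cmod (u n) <= B) ->
  exists l : C, forall (eps : R) (N : nat), 0 < eps ->
    exists p, (N <= p)%nat /\ Cmod (u p - l) < eps.
Proof.
  intros HB.
  assert (Hre : forall n, - B <= fst (u n) <= B).
  { intros n. generalize (HB n) (Rmax_Cmod (u n)) (Rmax_l (Rabs (fst (u n))) (Rabs (snd (u n)))).
    intros. apply Rabs_le_between. lra. }
  assert (Him : forall n, - B <= snd (u n) <= B).
  { intros n. generalize (HB n) (Rmax_Cmod (u n)) (Rmax_r (Rabs (fst (u n))) (Rabs (snd (u n)))).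
    intros. apply Rabs_le_between. lra. }
  destruct (Bolzano_Weierstrass (fun n => fst (u n)) _ (compact_P3 (- B) B) Hre) as [x Hx].
  assert (Hsub : forall k : nat, exists p, (k <= p)%nat /\ Rabs (fst (u p) - x) < / (INR k + 1)).
  { intros k. apply (Hx (fun t => Rabs (t - x) < / (INR k + 1)) k).
    assert (H0 : 0 < / (INR k + 1)) by (apply Rinv_0_lt_compat; generalize (pos_INR k); lra).
    exists (mkposreal _ H0). intros t Ht. exact Ht. }
  destruct (choice _ Hsub) as [phi Hphi].
  destruct (Bolzano_Weierstrass (fun k => snd (u (phi k))) _ (compact_P3 (- B) B)
              (fun k => Him (phi k))) as [y Hy].
  exists (x, y). intros eps N Heps.
  destruct (archimed_cor1 (eps / 2)) as [M [HM HM0]]; [lra|].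
  assert (H2 : 0 < eps / 2) by lra.
  destruct (Hy (fun t => Rabs (t - y) < eps / 2) (max N M)) as [k [Hk Hky]].
  { exists (mkposreal _ H2). intros t Ht. exact Ht. }
  destruct (Hphi k) as [Hk1 Hk2].
  exists (phi k). split; [lia|].
  assert (Hk3 : / (INR k + 1) < eps / 2).
  { apply Rle_lt_trans with (2 := HM). apply Rinv_le_contravar.
    - apply lt_0_INR; lia.
    - assert (INR M <= INR k) by (apply le_INR; lia). lra. }
  assert (Hd : (u (phi k) - (x, y))%C
     = ((fst (u (phi k)) - x)%R + Ci * (snd (u (phi k)) - y)%R)%C).
  { destruct (u (phi k)). unfold Cminus, Cplus, Cmult, Copp, Ci, RtoC; simpl.
    f_equal; ring. }
  rewrite Hd. eapply Rle_lt_trans; [apply Cmod_triangle|].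
  rewrite Cmod_mult, Cmod_Ci, !Cmod_R. lra.
Qed.

Lemma near_C_iff (z0 : C) (P : C -> Prop) :
  locally (T := CU) z0 P <->
  exists d : R, 0 < d /\ forall z : C, Cmod (z - z0) < d -> P z.
Proof.
  split.
  - intros [d Hd]. exists d. split; [apply cond_pos|]. intros z Hz. apply Hd. exact Hz.
  - intros [d [Hd H]]. exists (mkposreal d Hd). intros z Hz. apply H. exact Hz.
Qed.

Lemma continuous_real_C_iff (F : C -> R) (z0 : C) :
  continuous (T := CU) (U := R_UniformSpace) F z0 <->
  forall eps, 0 < eps -> locally (T := CU) z0 (fun z => Rabs (F z - F z0) < eps).
Proof.
  unfold continuous. rewrite filterlim_locally. split.
  - intros H eps Heps. exact (H (mkposreal eps Heps)).
  - intros H eps. exact (H eps (cond_pos eps)).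
Qed.

Lemma bounded_attains_max (F : C -> R) (rho B : R) :
  0 <= rho ->
  (forall z, Cmod z <= rho -> F z <= B) ->
  (forall z, Cmod z <= rho -> continuous (T := CU) (U := R_UniformSpace) F z) ->
  exists z0, Cmod z0 <= rho /\ forall z, Cmod z <= rho -> F z <= F z0.
Proof.
  intros Hrho HB HF.
  destruct (completeness (fun y => exists z, Cmod z <= rho /\ y = F z)) as [M [HM1 HM2]].
  { exists B. intros y [z [Hz ->]]. auto. }
  { exists (F 0). exists 0. rewrite Cmod_0. auto. }
  assert (Hseq : forall n : nat, exists z, Cmod z <= rho /\ M - / (INR n + 1) < F z).
  { intros n. apply NNPP. intros Hn.
    assert (Hn0 : 0 < / (INR n + 1)) by (apply Rinv_0_lt_compat; generalize (pos_INR n); lra).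
    assert (Hle : M <= M - / (INR n + 1)).
    { apply HM2. intros y [z [Hz ->]]. apply Rnot_lt_le. intros Hlt. apply Hn. eauto. }
    lra. }
  destruct (choice _ Hseq) as [u Hu].
  destruct (seq_C_cluster u rho) as [l Hl]; [intros n; apply Hu|].
  assert (Hlrho : Cmod l <= rho).
  { apply le_epsilon. intros eps Heps. destruct (Hl eps 0%nat Heps) as [p [_ Hp]].
    replace l with (u p - (u p - l))%C by ring.
    eapply Rle_trans; [apply Cmod_triangle|]. rewrite Cmod_opp.
    generalize (proj1 (Hu p)). lra. }
  exists l. split; [exact Hlrho|]. intros z Hz.
  apply Rle_trans with M; [apply HM1; eauto|].
  apply le_epsilon. intros eps Heps.
  assert (H2 : 0 < eps / 2) by lra.
  generalize (proj1 (continuous_real_C_iff F l) (HF l Hlrho) _ H2). intros Hc.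
  apply near_C_iff in Hc. destruct Hc as [d [Hd Hc]].
  destruct (archimed_cor1 (eps / 2)) as [N [HN HN0]]; [lra|].
  destruct (Hl d N Hd) as [p [Hp Hpl]].
  specialize (Hc _ Hpl). apply Rabs_lt_between in Hc.
  assert (/ (INR p + 1) < eps / 2).
  { apply Rle_lt_trans with (2 := HN). apply Rinv_le_contravar.
    - apply lt_0_INR; lia.
    - assert (INR N <= INR p) by (apply le_INR; lia). lra. }
  generalize (proj2 (Hu p)). lra.
Qed.

(** Composing with [atan] reduces to the case of a bounded function without moving
    the maximisers. *)
Lemma attains_max (F : C -> R) (rho : R) :
  0 <= rho ->
  (forall z, Cmod z <= rho -> continuous (T := CU) (U := R_UniformSpace) F z) ->
  exists z0, Cmod z0 <= rho /\ forall z, Cmod z <= rho -> F z <= F z0.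
Proof.
  intros Hrho HF.
  destruct (bounded_attains_max (fun z => atan (F z)) rho (PI / 2)) as [z0 [Hz0 Hmax]].
  - exact Hrho.
  - intros z _. generalize (atan_bound (F z)). lra.
  - intros z Hz. apply (continuous_comp (U := CU) (V := R_UniformSpace) (W := R_UniformSpace)); [auto|].
    apply continuity_pt_filterlim. apply derivable_continuous_pt, derivable_pt_atan.
  - exists z0. split; [exact Hz0|]. intros z Hz.
    apply Rnot_lt_le. intros Hlt. apply atan_increasing in Hlt.
    generalize (Hmax z Hz). lra.
Qed.

(** * Iterated difference quotients *)

(** [expandable n F z0] is a Taylor expansion of order [n] at [z0] with remainder
    [o((z - z0)^n)], organised as [F z = F z0 + (z - z0) * G z] with [G] of order
    [n - 1].  Continuity refers to the topology of the modulus, not to the product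
    topology of [C]; the two are related by [locally_C]. *)
Fixpoint expandable (n : nat) (F : C -> C) (z0 : C) : Prop :=
  match n with
  | O => continuous (T := CU) (U := CU) F z0
  | S k => exists G : C -> C,
      locally (T := CU) z0 (fun z => F z = (F z0 + (z - z0) * G z)%C) /\
      expandable k G z0
  end.

Lemma continuous_CU_iff (F : C -> C) (z0 : C) :
  continuous (T := CU) (U := CU) F z0 <->
  forall eps, 0 < eps -> locally (T := CU) z0 (fun z => Cmod (F z - F z0) < eps).
Proof.
  unfold continuous. rewrite filterlim_locally. split.
  - intros H eps Heps. exact (H (mkposreal eps Heps)).
  - intros H eps. exact (H eps (cond_pos eps)).
Qed.

Lemma continuous_Cplus (F G : C -> C) (z0 : C) :
  continuous (T := CU) (U := CU) F z0 -> continuous (T := CU) (U := CU) G z0 ->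
  continuous (T := CU) (U := CU) (fun z => (F z + G z)%C) z0.
Proof.
  intros HF HG.
  exact (continuous_plus (U := CU) (V := AbsRing_NormedModule C_AbsRing) F G z0 HF HG).
Qed.

Lemma continuous_Cmult (F G : C -> C) (z0 : C) :
  continuous (T := CU) (U := CU) F z0 -> continuous (T := CU) (U := CU) G z0 ->
  continuous (T := CU) (U := CU) (fun z => (F z * G z)%C) z0.
Proof.
  intros HF HG. exact (continuous_mult (U := CU) (K := C_AbsRing) F G z0 HF HG).
Qed.

Lemma continuous_Cmod (F : C -> C) (z0 : C) :
  continuous (T := CU) (U := CU) F z0 ->
  continuous (T := CU) (U := R_UniformSpace) (fun z => Cmod (F z)) z0.
Proof.
  intros HF.
  apply (continuous_comp (U := CU) (V := CU) (W := R_UniformSpace) F Cmod z0 HF).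
  exact (filterlim_norm (V := AbsRing_NormedModule C_AbsRing) (F z0)).
Qed.

Lemma continuous_Cinv (F : C -> C) (z0 : C) :
  F z0 <> 0 -> continuous (T := CU) (U := CU) F z0 ->
  continuous (T := CU) (U := CU) (fun z => (/ F z)%C) z0.
Proof.
  intros H0 HF. apply continuous_CU_iff. intros eps Heps.
  assert (Hm : 0 < Cmod (F z0)) by now apply Cmod_gt_0.
  set (m := Cmod (F z0)) in *.
  assert (He : 0 < Rmin (m / 2) (eps * (m * m) / 2)).
  { apply Rmin_pos; [lra|]. apply Rdiv_lt_0_compat; [|lra].
    apply Rmult_lt_0_compat; [lra|]. now apply Rmult_lt_0_compat. }
  generalize (proj1 (continuous_CU_iff F z0) HF _ He). apply filter_imp. intros z Hz.
  assert (Hz1 : Cmod (F z - F z0) < m / 2) by (eapply Rlt_le_trans; [exact Hz|apply Rmin_l]).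
  assert (Hz2 : Cmod (F z - F z0) < eps * (m * m) / 2)
    by (eapply Rlt_le_trans; [exact Hz|apply Rmin_r]).
  assert (Hlow : m / 2 < Cmod (F z)).
  { assert (m <= Cmod (F z) + Cmod (F z - F z0)).
    { unfold m. replace (F z0) with (F z + - (F z - F z0))%C at 1 by ring.
      eapply Rle_trans; [apply Cmod_triangle|]. rewrite Cmod_opp. lra. }
    lra. }
  assert (Hnz : F z <> 0) by (apply Cmod_gt_0; lra).
  replace (/ F z - / F z0)%C with (- (F z - F z0) / (F z * F z0))%C by now field.
  rewrite Cmod_div, Cmod_opp, Cmod_mult by now apply Cmult_neq_0. fold m.
  apply Rmult_lt_reg_r with (Cmod (F z) * m); [apply Rmult_lt_0_compat; lra|].
  unfold Rdiv at 1. rewrite Rmult_assoc, Rinv_l, Rmult_1_r.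
  - apply Rlt_trans with (1 := Hz2). assert (0 < eps * m) by nra. nra.
  - apply Rgt_not_eq, Rmult_lt_0_compat; lra.
Qed.

Lemma continuous_Cconst (c z0 : C) : continuous (T := CU) (U := CU) (fun _ => c) z0.
Proof. exact (continuous_const (U := CU) (V := CU) c z0). Qed.

Lemma continuous_Cid (z0 : C) : continuous (T := CU) (U := CU) (fun z : C => z) z0.
Proof. exact (continuous_id (U := CU) z0). Qed.

Lemma near_self (z0 : C) (P : C -> Prop) : locally (T := CU) z0 P -> P z0.
Proof. intros H. apply (locally_singleton (T := CU) z0 P H). Qed.

Lemma continuous_C_ext_loc (F G : C -> C) (z0 : C) :
  locally (T := CU) z0 (fun z => F z = G z) ->
  continuous (T := CU) (U := CU) F z0 -> continuous (T := CU) (U := CU) G z0.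
Proof.
  intros HFG HF P HP. rewrite <- (near_self _ _ HFG) in HP.
  generalize (filter_and _ _ HFG (HF P HP)). unfold filtermap. apply filter_imp.
  intros z [<- Hz]. exact Hz.
Qed.

Lemma expandable_continuous n F z0 :
  expandable n F z0 -> continuous (T := CU) (U := CU) F z0.
Proof.
  revert F. induction n as [|n IH]; intros F; [auto|].
  intros [G [HF HG]].
  apply (continuous_C_ext_loc (fun z => (F z0 + (z - z0) * G z)%C)).
  - revert HF. apply filter_imp. intros z Hz. now rewrite Hz.
  - apply continuous_Cplus; [apply continuous_Cconst|].
    apply continuous_Cmult; [|now apply IH].
    apply continuous_Cplus; [apply continuous_Cid|apply continuous_Cconst].
Qed.

Lemma expandable_S n F z0 : expandable (S n) F z0 -> expandable n F z0.
Proof.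
  revert F. induction n as [|n IH]; intros F HF.
  - now apply expandable_continuous in HF.
  - destruct HF as [G [HF HG]]. exists G. auto.
Qed.

Lemma expandable_ext_loc n (F G : C -> C) z0 :
  locally (T := CU) z0 (fun z => F z = G z) -> expandable n F z0 -> expandable n G z0.
Proof.
  intros HFG. destruct n as [|n].
  - now apply continuous_C_ext_loc.
  - intros [K [HF HK]]. exists K. split; [|exact HK].
    generalize (near_self _ _ HFG). intros H0.
    generalize (filter_and _ _ HFG HF). apply filter_imp. intros z [<- Hz].
    now rewrite <- H0.
Qed.

Lemma expandable_const n (c z0 : C) : expandable n (fun _ => c) z0.
Proof.
  revert c. induction n as [|n IH]; intros c; [apply continuous_Cconst|].
  exists (fun _ => 0%C). split; [|apply IH].
  apply filter_forall. intros z. ring.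
Qed.

Lemma expandable_id n (z0 : C) : expandable n (fun z : C => z) z0.
Proof.
  destruct n as [|n]; [apply continuous_Cid|].
  exists (fun _ => 1%C). split; [|apply expandable_const].
  assert (E : forall z : C, z = (z0 + (z - z0) * 1)%C) by (intros z; ring).
  apply filter_forall. exact E.
Qed.

Lemma expandable_plus n (F G : C -> C) z0 :
  expandable n F z0 -> expandable n G z0 -> expandable n (fun z => (F z + G z)%C) z0.
Proof.
  revert F G. induction n as [|n IH]; intros F G; [apply continuous_Cplus|].
  intros [F1 [HF HF1]] [G1 [HG HG1]].
  exists (fun z => (F1 z + G1 z)%C). split; [|now apply IH].
  generalize (filter_and _ _ HF HG). apply filter_imp. intros z [Hz1 Hz2].
  rewrite Hz1, Hz2. ring.
Qed.

(** [F G - F(z0) G(z0) = (z - z0) (F1 G + F(z0) G1)] for the slopes [F1], [G1] of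
    [F], [G]; the term [F1 G] is why the induction also needs the inclusion of the
    classes [expandable n] in each other. *)
Lemma expandable_mult n (F G : C -> C) z0 :
  expandable n F z0 -> expandable n G z0 -> expandable n (fun z => (F z * G z)%C) z0.
Proof.
  revert F G. induction n as [|n IH]; intros F G; [apply continuous_Cmult|].
  intros HF' HG'. generalize HF' HG'. intros [F1 [HF HF1]] [G1 [HG HG1]].
  exists (fun z => (F1 z * G z + F z0 * G1 z)%C). split.
  - generalize (filter_and _ _ HF HG). apply filter_imp. intros z [Hz1 Hz2].
    rewrite Hz1, Hz2. ring.
  - apply expandable_plus; apply IH; auto using expandable_S, expandable_const.
Qed.

(** The slope of [/ F] is [- F1 / (F(z0) F)], which contains [/ F] again, one order
    lower. *)
Lemma expandable_inv n (F : C -> C) z0 :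
  F z0 <> 0 -> expandable n F z0 -> expandable n (fun z => (/ F z)%C) z0.
Proof.
  intros H0. induction n as [|n IH]; [now apply continuous_Cinv|].
  intros HF'. generalize HF'. intros [F1 [HF HF1]].
  exists (fun z => (- / F z0 * (F1 z * / F z))%C). split.
  - assert (Hnz : locally (T := CU) z0 (fun z => F z <> 0)).
    { generalize (continuous_Cmod F z0 (expandable_continuous _ _ _ HF')).
      intros Hc. apply Cmod_gt_0 in H0.
      generalize (proj1 (continuous_real_C_iff _ _) Hc _ H0).
      apply filter_imp. intros z Hz. apply Cmod_gt_0.
      apply Rabs_lt_between in Hz. lra. }
    generalize (filter_and _ _ HF Hnz). apply filter_imp. intros z [Hz1 Hz2].
    assert (E : (F1 z * (z - z0))%C = (F z - F z0)%C) by (rewrite Hz1; ring).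
    transitivity (/ F z0 + - / F z0 * ((F1 z * (z - z0)) * / F z))%C; [|ring].
    rewrite E. now field.
  - apply expandable_mult; [apply expandable_const|].
    apply expandable_mult; [exact HF1|]. apply IH. now apply expandable_S.
Qed.

Lemma C_derive_of_slope (F G : C -> C) (z0 : C) :
  locally (T := CU) z0 (fun z => F z = (F z0 + (z - z0) * G z)%C) ->
  continuous (T := CU) (U := CU) G z0 -> C_derive F z0 = G z0.
Proof.
  intros HF HG. apply is_C_lim_unique.
  intros P HP. apply locally_C in HP. unfold filtermap, locally', within.
  apply locally_C.
  generalize (filter_and _ _ HF (HG _ HP)). apply filter_imp.
  intros z [Hz Pz] Hne. rewrite Hz.
  replace ((F z0 + (z - z0) * G z - F z0) / (z - z0))%C with (G z); [exact Pz|].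
  field. now apply Cminus_eq_contra.
Qed.

Lemma expandable_derive_slope n (F : C -> C) (z0 : C) :
  expandable (S n) F z0 -> exists G : C -> C,
    G z0 = C_derive F z0 /\ expandable n G z0 /\
    locally (T := CU) z0 (fun z => F z = (F z0 + (z - z0) * G z)%C).
Proof.
  intros [G [HF HG]]. exists G. split; [|now split].
  symmetry. apply C_derive_of_slope; [exact HF|].
  now apply expandable_continuous in HG.
Qed.

(** * The maximum principle and the Schwarz-Pick lemma *)

Lemma pow2_le_inv (x y : R) : 0 <= y -> x ^ 2 <= y ^ 2 -> x <= y.
Proof. intros Hy H. apply Rsqr_incr_0_var; [|exact Hy]. now rewrite !Rsqr_pow2. Qed.

Lemma Cmod_sqr (z : C) : Cmod z ^ 2 = fst z ^ 2 + snd z ^ 2.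
Proof. exact (Cmod2_alt z). Qed.

Lemma Cmod_triangle_minus (x y : C) : Cmod x - Cmod y <= Cmod (x - y).
Proof.
  assert (Cmod x <= Cmod (x - y) + Cmod y).
  { replace x with ((x - y) + y)%C at 1 by ring. apply Cmod_triangle. }
  lra.
Qed.

(** In the sum of [Q] over [z0 + c s], where [c] runs through the fourth roots of
    unity, the terms of order one and two in [s] cancel, so that the mean of [|Q|] is
    at least [|Q z0| - o(s^2)]; the mean of [eps |z|^2] exceeds [eps |z0|^2] by
    [eps s^2].  The perturbation by [eps |z|^2] thus turns the maximum principle into
    a statement about the Taylor expansion of order two at a single point. *)
Lemma no_local_max (Q : C -> C) (z0 : C) (eps : R) :
  0 < eps -> expandable 2 Q z0 ->
  ~ locally (T := CU) z0
      (fun z => Cmod (Q z) + eps * Cmod z ^ 2 <= Cmod (Q z0) + eps * Cmod z0 ^ 2).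
Proof.
  intros Heps [G [HQ [K [HG HK]]]] Hmax.
  assert (He2 : 0 < eps / 2) by lra.
  generalize (proj1 (continuous_CU_iff K z0) HK _ He2). intros HK'.
  generalize (filter_and _ _ Hmax (filter_and _ _ HQ (filter_and _ _ HG HK'))).
  clear HQ HG HK HK' Hmax. intros H. apply near_C_iff in H. destruct H as [d [Hd H]].
  set (s := d / 2).
  assert (Hs : 0 < s) by (unfold s; lra).
  assert (P : forall c : C, Cmod c = 1 ->
    exists k : C, Cmod k < eps / 2 /\
      Q (z0 + c * s)%C = (Q z0 + c * s * G z0 + (c * s) * (c * s) * (K z0 + k))%C /\
      Cmod (Q (z0 + c * s)%C)
        <= Cmod (Q z0) + eps * Cmod z0 ^ 2 - eps * Cmod (z0 + c * s) ^ 2).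
  { intros c Hc.
    assert (E : (z0 + c * s - z0)%C = (c * s)%C) by ring.
    assert (Hz : Cmod (z0 + c * s - z0) < d).
    { rewrite E, Cmod_mult, Hc, Cmod_R, Rabs_right by lra. unfold s. lra. }
    destruct (H _ Hz) as [H1 [H2 [H3 H4]]].
    exists (K (z0 + c * s) - K z0)%C. split; [exact H4|]. split; [|lra].
    rewrite H2, H3, E. ring. }
  assert (C1 : Cmod 1 = 1) by apply Cmod_1.
  assert (C2 : Cmod (- (1)) = 1) by apply Cmod_m1.
  assert (C3 : Cmod Ci = 1) by apply Cmod_Ci.
  assert (C4 : Cmod (- Ci) = 1) by (rewrite Cmod_opp; apply Cmod_Ci).
  destruct (P _ C1) as [k1 [K1 [E1 L1]]]. destruct (P _ C2) as [k2 [K2 [E2 L2]]].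
  destruct (P _ C3) as [k3 [K3 [E3 L3]]]. destruct (P _ C4) as [k4 [K4 [E4 L4]]].
  assert (Hii : (Ci * Ci)%C = (- (1))%C) by (unfold Ci, Cmult, Copp, RtoC; simpl; f_equal; ring).
  assert (Sum : (4 * Q z0)%C =
    (Q (z0 + 1 * s) + Q (z0 + - (1) * s) + (Q (z0 + Ci * s) + Q (z0 + - Ci * s))
       - s * s * ((k1 + k2) - (k3 + k4)))%C).
  { rewrite E1, E2, E3, E4.
    replace (Ci * s * (Ci * s))%C with (- (s * s))%C.
    2:{ transitivity (Ci * Ci * (s * s))%C; [rewrite Hii|]; ring. }
    replace (- Ci * s * (- Ci * s))%C with (- (s * s))%C.
    2:{ transitivity (Ci * Ci * (s * s))%C; [rewrite Hii|]; ring. }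
    ring. }
  apply (f_equal Cmod) in Sum. rewrite Cmod_mult in Sum.
  rewrite Cmod_R, Rabs_right in Sum by lra.
  set (q1 := Q (z0 + 1 * s)%C) in *. set (q2 := Q (z0 + - (1) * s)%C) in *.
  set (q3 := Q (z0 + Ci * s)%C) in *. set (q4 := Q (z0 + - Ci * s)%C) in *.
  assert (Up : 4 * Cmod (Q z0) <=
     Cmod q1 + Cmod q2 + (Cmod q3 + Cmod q4)
     + s * s * ((Cmod k1 + Cmod k2) + (Cmod k3 + Cmod k4))).
  { rewrite Sum. unfold Cminus at 1.
    eapply Rle_trans; [apply Cmod_triangle|]. apply Rplus_le_compat.
    - eapply Rle_trans; [apply Cmod_triangle|].
      apply Rplus_le_compat; apply Cmod_triangle.
    - rewrite Cmod_opp, !Cmod_mult, Cmod_R, Rabs_right by lra.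
      apply Rmult_le_compat_l; [nra|].
      eapply Rle_trans; [apply Cmod_triangle|]. rewrite Cmod_opp.
      apply Rplus_le_compat; apply Cmod_triangle. }
  assert (Par : Cmod (z0 + 1 * s) ^ 2 + Cmod (z0 + - (1) * s) ^ 2
     + (Cmod (z0 + Ci * s) ^ 2 + Cmod (z0 + - Ci * s) ^ 2)
     = 4 * Cmod z0 ^ 2 + 4 * (s * s)).
  { rewrite !Cmod_sqr. destruct z0 as [x y].
    unfold Ci, Cplus, Cmult, Copp, RtoC; simpl. ring. }
  assert (0 < s * s) by nra.
  nra.
Qed.

(** The maximum principle for [psi z / z], whose value at [0] is supplied by the
    slope of [psi] there.  The expansion of order three of [psi] leaves order two
    for this quotient. *)
Lemma schwarz (psi : C -> C) :
  (forall z, Cmod z < 1 -> expandable 3 psi z) ->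
  (forall z, Cmod z < 1 -> Cmod (psi z) <= 1) ->
  psi 0 = 0 ->
  forall z, Cmod z < 1 -> Cmod (psi z) <= Cmod z.
Proof.
  intros Hex Hb H0.
  destruct (Hex 0) as [G [HG HG2]]; [rewrite Cmod_0; lra|].
  set (Q := fun z : C => if Ceq_dec z 0 then G 0 else (psi z * / z)%C).
  assert (Hnz : forall z : C, z <> 0 -> Q z = (psi z * / z)%C).
  { intros z Hz. unfold Q. destruct (Ceq_dec z 0); [contradiction|reflexivity]. }
  assert (HQ : forall z, Cmod z < 1 -> expandable 2 Q z).
  { intros z Hz. destruct (Ceq_dec z 0) as [->|Hne].
    - apply (expandable_ext_loc _ G); [|exact HG2].
      revert HG. apply filter_imp. intros z Hz1.
      unfold Q. destruct (Ceq_dec z 0) as [->|Hne]; [reflexivity|].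
      rewrite Hz1, H0. field. exact Hne.
    - apply (expandable_ext_loc _ (fun z => (psi z * / z)%C)).
      + apply near_C_iff. exists (Cmod z). split; [now apply Cmod_gt_0|].
        intros y Hy. rewrite Hnz; [reflexivity|]. intros ->.
        replace (0 - z)%C with (- z)%C in Hy by ring. rewrite Cmod_opp in Hy. lra.
      + apply expandable_mult; [now apply expandable_S, Hex|].
        apply expandable_inv; [exact Hne|apply expandable_id]. }
  assert (Hrho : forall rho eps z, 0 < rho < 1 -> 0 < eps -> Cmod z <= rho ->
            Cmod (Q z) <= / rho + eps).
  { intros rho eps z Hr Heps Hz.
    destruct (attains_max (fun z => Cmod (Q z) + eps * Cmod z ^ 2) rho) as [m [Hm Hmax]]; [lra| |].
    - intros y Hy.
      assert (Hq : continuous (T := CU) (U := R_UniformSpace) (fun z => Cmod (Q z)) y).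
      { apply continuous_Cmod. apply (expandable_continuous 2). apply HQ. lra. }
      assert (Hi : continuous (T := CU) (U := R_UniformSpace) (fun z : C => Cmod z) y)
        by (apply continuous_Cmod, continuous_Cid).
      apply (continuous_plus (U := CU) (V := R_NormedModule) (fun z => Cmod (Q z))
               (fun z => eps * Cmod z ^ 2) y Hq).
      apply (continuous_mult (U := CU) (K := R_AbsRing) (fun _ => eps) (fun z => Cmod z ^ 2) y).
      + apply (continuous_const (U := CU) (V := R_UniformSpace)).
      + apply (continuous_mult (U := CU) (K := R_AbsRing) Cmod (fun z => Cmod z * 1) y Hi).
        apply (continuous_mult (U := CU) (K := R_AbsRing) Cmod (fun z => 1) y Hi).
        apply (continuous_const (U := CU) (V := R_UniformSpace)).
    - destruct (Rle_lt_or_eq_dec _ _ Hm) as [Hlt|Heq].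
      + exfalso. apply (no_local_max Q m eps Heps); [apply HQ; lra|].
        apply near_C_iff. exists (rho - Cmod m). split; [lra|].
        intros y Hy. apply Hmax. generalize (Cmod_triangle_minus y m). lra.
      + assert (Hmne : m <> 0) by (apply Cmod_gt_0; lra).
        assert (Qm : Cmod (Q m) <= / rho).
        { rewrite Hnz, Cmod_mult, Cmod_inv, Heq by exact Hmne.
          rewrite <- (Rmult_1_l (/ rho)) at 2. apply Rmult_le_compat_r.
          - apply Rlt_le, Rinv_0_lt_compat; lra.
          - apply Hb. lra. }
        generalize (Hmax z Hz). rewrite Heq. intros Hmz.
        assert (0 <= eps * Cmod z ^ 2) by (apply Rmult_le_pos; [lra|apply pow2_ge_0]).
        assert (rho ^ 2 <= 1) by nra.
        assert (eps * rho ^ 2 <= eps) by nra.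
        lra. }
  intros z Hz. destruct (Ceq_dec z 0) as [->|Hne]; [rewrite H0; lra|].
  assert (Hz0 : 0 < Cmod z) by now apply Cmod_gt_0.
  assert (HQ1 : Cmod (Q z) <= 1).
  { apply le_epsilon. intros eps Heps.
    set (rho := Rmax (Cmod z) (/ (1 + eps / 2))).
    assert (He2 : / (1 + eps / 2) < 1).
    { rewrite <- Rinv_1. apply Rinv_lt_contravar; lra. }
    assert (Hr : 0 < rho < 1).
    { unfold rho. split; [eapply Rlt_le_trans; [exact Hz0|apply Rmax_l]|].
      now apply Rmax_lub_lt. }
    assert (Hr2 : / rho <= 1 + eps / 2).
    { rewrite <- (Rinv_inv (1 + eps / 2)). apply Rinv_le_contravar.
      - apply Rinv_0_lt_compat; lra.
      - apply Rmax_r. }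
    assert (He : 0 < eps / 2) by lra.
    generalize (Hrho rho (eps / 2) z Hr He (Rmax_l _ _)). lra. }
  rewrite Hnz, Cmod_mult, Cmod_inv in HQ1 by exact Hne.
  apply Rmult_le_reg_r with (/ Cmod z); [now apply Rinv_0_lt_compat|].
  rewrite Rinv_r by lra. exact HQ1.
Qed.

Lemma re_mult_conj_le (a b : C) : Re (a * Cconj b) <= Cmod a * Cmod b.
Proof.
  eapply Rle_trans; [apply Rle_abs|]. eapply Rle_trans; [apply re_le_Cmod|].
  rewrite Cmod_mult, Cmod_conj. lra.
Qed.

(** The Schwarz lemma for [(om - c) / (1 - conj c * om)], [c = om 0]. *)
Lemma schwarz_pick (om : C -> C) :
  (forall z, Cmod z < 1 -> expandable 3 om z) ->
  (forall z, Cmod z < 1 -> Cmod (om z) < 1) ->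
  forall z, Cmod z < 1 ->
    Cmod (om z) * (1 + Cmod (om 0) * Cmod z) <= Cmod (om 0) + Cmod z.
Proof.
  intros Hex Hb z Hz. set (c := om 0).
  assert (Hc : Cmod c < 1) by (apply Hb; rewrite Cmod_0; lra).
  set (psi := fun z => ((om z + - c) * / (1 + - Cconj c * om z))%C).
  assert (Hden : forall z, Cmod z < 1 -> (1 + - Cconj c * om z)%C <> 0).
  { intros y Hy E. generalize (Hb y Hy) (Cmod_ge_0 (om y)) (Cmod_ge_0 c). intros B1 B2 B3.
    assert (E2 : Cmod 1 = Cmod c * Cmod (om y)).
    { rewrite <- (Cmod_conj c), <- Cmod_mult. f_equal.
      transitivity ((1 + - Cconj c * om y) + Cconj c * om y)%C; [ring|]. rewrite E. ring. }
    rewrite Cmod_1 in E2. nra. }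
  assert (N1 : forall y, Cmod (om y + - c) ^ 2
                = Cmod (om y) ^ 2 - 2 * Re (om y * Cconj c) + Cmod c ^ 2).
  { intros y. rewrite !Cmod_sqr. destruct (om y), c. unfold Cconj, Cmult, Cplus, Copp, Re; simpl. ring. }
  assert (N2 : forall y, Cmod (1 + - Cconj c * om y) ^ 2
                = 1 - 2 * Re (om y * Cconj c) + Cmod c ^ 2 * Cmod (om y) ^ 2).
  { intros y. rewrite !Cmod_sqr. destruct (om y), c. unfold Cconj, Cmult, Cplus, Copp, RtoC, Re; simpl. ring. }
  assert (Hpsi : Cmod (psi z) <= Cmod z).
  { apply schwarz; [| | |exact Hz].
    - intros y Hy. unfold psi. apply expandable_mult.
      + apply expandable_plus; [now apply Hex|apply expandable_const].
      + apply expandable_inv; [now apply Hden|].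
        apply expandable_plus; [apply expandable_const|].
        apply expandable_mult; [apply expandable_const|now apply Hex].
    - intros y Hy. unfold psi.
      assert (Hp : 0 < Cmod (1 + - Cconj c * om y)) by now apply Cmod_gt_0, Hden.
      rewrite Cmod_mult, Cmod_inv by now apply Hden.
      apply Rmult_le_reg_r with (1 := Hp). rewrite Rmult_assoc, Rinv_l by lra.
      rewrite Rmult_1_r, Rmult_1_l.
      apply pow2_le_inv; [lra|].
      rewrite N1, N2. generalize (Hb y Hy) (Cmod_ge_0 (om y)) (Cmod_ge_0 c). intros B1 B2 B3.
      assert (Cmod c ^ 2 < 1) by nra. assert (Cmod (om y) ^ 2 < 1) by nra. nra.
    - unfold psi. fold c. ring. }
  assert (Hp : 0 < Cmod (1 + - Cconj c * om z)) by now apply Cmod_gt_0, Hden.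
  assert (Hle : Cmod (om z + - c) <= Cmod z * Cmod (1 + - Cconj c * om z)).
  { unfold psi in Hpsi. rewrite Cmod_mult, Cmod_inv in Hpsi by now apply Hden.
    apply Rmult_le_reg_r with (/ Cmod (1 + - Cconj c * om z)).
    - now apply Rinv_0_lt_compat.
    - rewrite Rmult_assoc, Rinv_r by lra. lra. }
  assert (Hsq : Cmod (om z + - c) ^ 2 <= Cmod z ^ 2 * Cmod (1 + - Cconj c * om z) ^ 2).
  { rewrite <- Rpow_mult_distr. apply pow_incr. split; [apply Cmod_ge_0|exact Hle]. }
  rewrite N1, N2 in Hsq.
  generalize (re_mult_conj_le (om z) c) (Cmod_ge_0 z) (Cmod_ge_0 c) (Cmod_ge_0 (om z)) (Hb z Hz).
  set (x := Cmod (om z)) in *. set (b := Cmod c) in *. set (r := Cmod z) in *.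
  intros Hre Hr0 Hb0 Hx0 Hx1.
  assert (Hfin : (x - b) ^ 2 <= (r * (1 - b * x)) ^ 2).
  { assert (0 <= 1 - r ^ 2) by nra. nra. }
  assert (0 <= r * (1 - b * x)) by (apply Rmult_le_pos; nra).
  assert (x - b <= r * (1 - b * x)).
  { now apply pow2_le_inv. }
  lra.
Qed.

(** * Power series *)

Notation cseries := (is_series (K := C_AbsRing) (V := C_NormedModule)).

Lemma pow_n_Cpow (z : C) (n : nat) : pow_n (K := C_AbsRing) z n = (z ^ n)%C.
Proof. induction n as [|n IH]; [reflexivity|]. rewrite Cpow_S, <- IH. reflexivity. Qed.

Lemma is_pseries_C_iff (a : nat -> C) (x l : C) :
  is_pseries (K := C_AbsRing) (V := C_NormedModule) a x l <->
  cseries (fun n => (a n * x ^ n)%C) l.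
Proof.
  unfold is_pseries.
  assert (E : forall n, scal (pow_n (K := C_AbsRing) x n) (a n) = (a n * x ^ n)%C).
  { intros n. rewrite pow_n_Cpow. apply Cmult_comm. }
  split; apply is_series_ext; intros n; [apply E|symmetry; apply E].
Qed.

Lemma cseries_Cmod_le (a : nat -> C) (b : nat -> R) (la : C) (lb : R) :
  cseries a la -> is_series b lb -> (forall n, Cmod (a n) <= b n) -> Cmod la <= lb.
Proof.
  intros Ha Hb Hle.
  assert (L1 : is_lim_seq (fun n => Cmod (sum_n a n)) (Cmod la)).
  { exact (filterlim_comp _ _ _ _ _ _ _ _ Ha (filterlim_norm (V := C_NormedModule) la)). }
  assert (L2 : is_lim_seq (sum_n b) lb) by exact Hb.
  refine (is_lim_seq_le _ _ (Cmod la) lb _ L1 L2).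
  intros n. eapply Rle_trans; [exact (norm_sum_n_m (V := C_NormedModule) a 0 n)|].
  apply sum_n_m_le. exact Hle.
Qed.

Lemma cseries_terms_bounded (a : nat -> C) (l : C) :
  cseries a l -> exists M, forall n, Cmod (a n) <= M.
Proof.
  intros Ha.
  assert (L1 : is_lim_seq (fun n => Cmod (sum_n a n)) (Cmod l)).
  { exact (filterlim_comp _ _ _ _ _ _ _ _ Ha (filterlim_norm (V := C_NormedModule) l)). }
  destruct (filterlim_bounded (V := R_NormedModule) (fun n => Cmod (sum_n a n))) as [M HM].
  { exists (Cmod l). exact L1. }
  assert (HM' : forall n, Cmod (sum_n a n) <= M).
  { intros n. eapply Rle_trans; [|exact (HM n)]. apply Rle_abs. }
  exists (M + M). intros n. destruct n as [|n].
  - generalize (HM' 0%nat) (Cmod_ge_0 (a 0%nat)). rewrite sum_O. lra.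
  - replace (a (S n)) with (sum_n a (S n) - sum_n a n)%C.
    + unfold Cminus. eapply Rle_trans; [apply Cmod_triangle|]. rewrite Cmod_opp.
      generalize (HM' n) (HM' (S n)). lra.
    + rewrite sum_Sn. change (plus (sum_n a n) (a (S n))) with (sum_n a n + a (S n))%C. ring.
Qed.

(** Comparison with the geometric series of ratio [s / r]. *)
Lemma cpseries_abs_conv (a : nat -> C) (s r : R) (l : C) :
  0 <= s < r -> cseries (fun n => (a n * r ^ n)%C) l ->
  ex_series (fun n => Cmod (a n) * s ^ n).
Proof.
  intros Hs Ha. destruct (cseries_terms_bounded _ _ Ha) as [M HM].
  apply (ex_series_le (V := R_CompleteNormedModule)) with (b := fun n => M * (s / r) ^ n).
  - intros n. unfold norm; simpl. unfold abs; simpl.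
    assert (Hp : 0 < r ^ n) by (apply pow_lt; lra).
    assert (Hs0 : 0 <= s ^ n) by (apply pow_le; lra).
    rewrite Rabs_right by (apply Rle_ge, Rmult_le_pos; [apply Cmod_ge_0|exact Hs0]).
    unfold Rdiv. rewrite Rpow_mult_distr, pow_inv.
    specialize (HM n). rewrite Cmod_mult, <- RtoC_pow, Cmod_R, Rabs_right in HM by lra.
    apply Rmult_le_reg_r with (1 := Hp).
    replace (M * (s ^ n * / r ^ n) * r ^ n) with (M * s ^ n) by (field; lra).
    nra.
  - apply (ex_series_scal_l (V := R_NormedModule) M (fun n => (s / r) ^ n)). apply ex_series_geom.
    rewrite Rabs_right; [|apply Rle_ge, Rdiv_le_0_compat; lra].
    apply Rmult_lt_reg_r with r; [lra|]. unfold Rdiv. rewrite Rmult_assoc, Rinv_l; lra.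
Qed.

Lemma cseries_of_abs (a : nat -> C) (b : nat -> R) :
  (forall n, Cmod (a n) <= b n) -> ex_series b -> exists l, cseries a l.
Proof.
  intros Hle Hb. exact (ex_series_le (V := C_CompleteNormedModule) a b Hle Hb).
Qed.

Lemma cseries_incr_1 (b : nat -> C) (l : C) :
  cseries b l -> cseries (fun k => b (S k)) (l - b 0%nat)%C.
Proof.
  intros H. apply (is_series_incr_1 (V := C_NormedModule) b).
  assert (E : l = (l - b 0%nat + b 0%nat)%C) by ring.
  rewrite E in H. exact H.
Qed.

Lemma cpseries_tail (a : nat -> C) (x l : C) :
  x <> 0 -> cseries (fun n => (a n * x ^ n)%C) l ->
  cseries (fun n => (a (S n) * x ^ n)%C) (/ x * (l - a 0%nat))%C.
Proof.
  intros Hx Ha.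
  assert (H1 : cseries (fun n => (a (S n) * x ^ (S n))%C) (l - a 0%nat)%C).
  { replace (l - a 0%nat)%C with (l - a 0%nat * x ^ 0)%C by (simpl; ring).
    exact (cseries_incr_1 _ _ Ha). }
  apply (is_series_scal (V := C_NormedModule) (/ x)%C) in H1.
  revert H1. apply is_series_ext. intros n.
  change ((/ x * (a (S n) * (x * x ^ n)))%C = (a (S n) * x ^ n)%C). field. exact Hx.
Qed.

(** The slope of a power series is the series with shifted coefficients; away from the
    centre it is determined by [F], and at the centre it is the coefficient [a 1]. *)
Lemma analytic_slope (F : C -> C) (z0 : C) (a : nat -> C) (r : R) :
  0 < r ->
  (forall z, Cmod (z - z0) < r -> cseries (fun n => (a n * (z - z0) ^ n)%C) (F z)) ->
  exists G : C -> C,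
    (forall z, Cmod (z - z0) < r -> F z = (F z0 + (z - z0) * G z)%C) /\
    (forall z, Cmod (z - z0) < r -> cseries (fun n => (a (S n) * (z - z0) ^ n)%C) (G z)).
Proof.
  intros Hr HF.
  assert (H0 : forall b : nat -> C, cseries (fun n => (b n * 0 ^ n)%C) (b 0%nat)).
  { intros b.
    assert (E : forall n, b 0%nat = sum_n (G := C_AbelianMonoid) (fun n => (b n * 0 ^ n)%C) n).
    { induction n as [|n IH].
      - rewrite sum_O. simpl. ring.
      - rewrite sum_Sn, <- IH. change (b 0%nat = (b 0%nat + b (S n) * (0 * 0 ^ n))%C). ring. }
    apply (filterlim_ext _ _ E), filterlim_const. }
  assert (F0 : F z0 = a 0%nat).
  { assert (Hz : Cmod (z0 - z0) < r).
    { replace (z0 - z0)%C with (RtoC 0) by ring. rewrite Cmod_0. exact Hr. }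
    specialize (HF z0 Hz). replace (z0 - z0)%C with (RtoC 0) in HF by ring.
    exact (filterlim_locally_unique (V := C_NormedModule) _ _ _ HF (H0 a)). }
  exists (fun z => if Ceq_dec z z0 then a 1%nat else (/ (z - z0) * (F z - a 0%nat))%C).
  split; intros z Hz; destruct (Ceq_dec z z0) as [->|Hne].
  - ring.
  - rewrite F0. field. now apply Cminus_eq_contra.
  - replace (z0 - z0)%C with (RtoC 0) by ring. apply (H0 (fun n => a (S n))).
  - apply cpseries_tail; [now apply Cminus_eq_contra|now apply HF].
Qed.

(** The slope is bounded near the centre, being a power series itself. *)
Lemma cpseries_continuous (F : C -> C) (z0 : C) (a : nat -> C) (r : R) :
  0 < r ->
  (forall z, Cmod (z - z0) < r -> cseries (fun n => (a n * (z - z0) ^ n)%C) (F z)) ->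
  continuous (T := CU) (U := CU) F z0.
Proof.
  intros Hr HF. destruct (analytic_slope F z0 a r Hr HF) as [G [HG1 HG2]].
  assert (Hh : Cmod (z0 + (r / 2)%R - z0) < r).
  { replace (z0 + (r / 2)%R - z0)%C with (RtoC (r / 2)) by ring.
    rewrite Cmod_R, Rabs_right; lra. }
  generalize (HG2 _ Hh). replace (z0 + (r / 2)%R - z0)%C with (RtoC (r / 2)) by ring.
  intros Hs. assert (Hr4 : 0 <= r / 4 < r / 2) by lra.
  destruct (cpseries_abs_conv (fun n => a (S n)) (r / 4) (r / 2) _ Hr4 Hs) as [B HB].
  assert (GB : forall z, Cmod (z - z0) < r / 4 -> Cmod (G z) <= B).
  { intros z Hz. assert (Hz' : Cmod (z - z0) < r) by lra.
    refine (cseries_Cmod_le _ _ _ _ (HG2 z Hz') HB _).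
    intros n. rewrite Cmod_mult, Cmod_pow. apply Rmult_le_compat_l; [apply Cmod_ge_0|].
    apply pow_incr. split; [apply Cmod_ge_0|lra]. }
  assert (B0 : 0 <= B).
  { eapply Rle_trans; [apply (Cmod_ge_0 (G z0))|]. apply GB.
    replace (z0 - z0)%C with (RtoC 0) by ring. rewrite Cmod_0. lra. }
  apply continuous_CU_iff. intros eps Heps. apply near_C_iff.
  exists (Rmin (r / 4) (eps / (B + 1))). split.
  { apply Rmin_pos; [lra|]. apply Rdiv_lt_0_compat; lra. }
  intros z Hz.
  assert (Hz1 : Cmod (z - z0) < r / 4) by (eapply Rlt_le_trans; [exact Hz|apply Rmin_l]).
  assert (Hz2 : Cmod (z - z0) < eps / (B + 1)) by (eapply Rlt_le_trans; [exact Hz|apply Rmin_r]).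
  rewrite (HG1 z) by lra.
  replace (F z0 + (z - z0) * G z - F z0)%C with ((z - z0) * G z)%C by ring.
  rewrite Cmod_mult. generalize (GB z Hz1) (Cmod_ge_0 (z - z0)) (Cmod_ge_0 (G z)). intros.
  apply Rmult_lt_compat_r with (r := B + 1) in Hz2; [|lra].
  unfold Rdiv in Hz2. rewrite Rmult_assoc, Rinv_l, Rmult_1_r in Hz2 by lra. nra.
Qed.

Lemma cpseries_expandable (n : nat) (F : C -> C) (z0 : C) (a : nat -> C) (r : R) :
  0 < r ->
  (forall z, Cmod (z - z0) < r -> cseries (fun n => (a n * (z - z0) ^ n)%C) (F z)) ->
  expandable n F z0.
Proof.
  intros Hr. revert F a. induction n as [|n IH]; intros F a HF.
  - now apply cpseries_continuous with a r.
  - destruct (analytic_slope F z0 a r Hr HF) as [G [HG1 HG2]].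
    exists G. split; [|now apply IH with (fun n => a (S n))].
    apply near_C_iff. eauto.
Qed.

Lemma analytic_expandable (n : nat) (F : C -> C) (z0 : C) :
  analytic_at F z0 -> expandable n F z0.
Proof.
  intros [a [r [Hr HF]]]. apply cpseries_expandable with a r; [exact Hr|].
  intros z Hz. apply (proj1 (is_pseries_C_iff _ _ _)). now apply HF.
Qed.

(** [n s^(n-1) d] is one term of the binomial expansion of [(s + d)^n].  Bounds of
    this kind make the differentiated series converge by comparison with the original
    one on a slightly larger disk. *)
Lemma Cpow_deriv_bound (w : C) (s d : R) (n : nat) :
  0 <= d -> Cmod w <= s -> Cmod (INR n * w ^ (pred n))%C * d <= (s + d) ^ n.
Proof.
  intros Hd Hw. rewrite Cmod_mult, Cmod_R, Cmod_pow, Rabs_right by apply Rle_ge, pos_INR.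
  generalize (Cmod_ge_0 w). intros Hw0.
  induction n as [|n IH]; [simpl; lra|].
  destruct n as [|n]; [simpl in *; lra|].
  rewrite S_INR. simpl pred in *. rewrite <- (tech_pow_Rmult (s + d) (S n)).
  assert (E : Cmod w ^ S n <= (s + d) ^ S n) by (apply pow_incr; lra).
  assert (E0 : 0 <= Cmod w ^ n) by now apply pow_le.
  assert (E1 : 0 <= INR (S n) * Cmod w ^ n * d).
  { apply Rmult_le_pos; [apply Rmult_le_pos; [apply pos_INR|exact E0]|exact Hd]. }
  replace ((INR (S n) + 1) * Cmod w ^ S n * d)
    with (Cmod w * (INR (S n) * Cmod w ^ n * d) + Cmod w ^ S n * d) by (simpl pow; ring).
  nra.
Qed.

(** If [D n] is the remainder, then
    [D (n + 1) = z * D n + (z - w)^2 * n * w^(n - 1)]; the bound [(s + d)^n / d^2]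
    is propagated by this recursion. *)
Lemma Cpow_taylor_bound (z w : C) (s d : R) (n : nat) :
  0 <= d -> Cmod z <= s -> Cmod w <= s ->
  Cmod (z ^ n - w ^ n - (z - w) * (INR n * w ^ (pred n)))%C * d ^ 2
    <= Cmod (z - w) ^ 2 * (s + d) ^ n.
Proof.
  intros Hd Hz Hw.
  induction n as [|n IH].
  - simpl. replace (1 - 1 - (z - w) * (0 * 1))%C with (RtoC 0) by ring.
    rewrite Cmod_0. generalize (Cmod_ge_0 (z - w)). nra.
  - set (D := (z ^ n - w ^ n - (z - w) * (INR n * w ^ pred n))%C) in *.
    set (T := (INR n * w ^ pred n)%C) in *.
    assert (E : (z ^ S n - w ^ S n - (z - w) * (INR (S n) * w ^ pred (S n)))%C
                = (z * D + (z - w) * (z - w) * T)%C).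
    { unfold D, T. simpl pred. rewrite S_INR, RtoC_plus, !Cpow_S.
      destruct n as [|n]; [simpl; ring|]. simpl pred. rewrite !Cpow_S. ring. }
    rewrite E. clear E.
    assert (HT : Cmod T * d <= (s + d) ^ n) by now apply Cpow_deriv_bound.
    assert (Hp : 0 <= (s + d) ^ n).
    { apply pow_le. generalize (Cmod_ge_0 z). lra. }
    apply Rle_trans with ((Cmod z * Cmod D + Cmod (z - w) ^ 2 * Cmod T) * d ^ 2).
    + apply Rmult_le_compat_r; [apply pow2_ge_0|].
      eapply Rle_trans; [apply Cmod_triangle|]. rewrite !Cmod_mult. right. ring.
    + rewrite <- (tech_pow_Rmult (s + d) n).
      generalize (Cmod_ge_0 z) (Cmod_ge_0 D) (Cmod_ge_0 T) (pow2_ge_0 (Cmod (z - w))) (pow2_ge_0 d).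
      intros P1 P2 P3 P4 P5.
      replace ((Cmod z * Cmod D + Cmod (z - w) ^ 2 * Cmod T) * d ^ 2)
        with (Cmod z * (Cmod D * d ^ 2) + d * (Cmod (z - w) ^ 2 * (Cmod T * d))) by ring.
      replace (Cmod (z - w) ^ 2 * ((s + d) * (s + d) ^ n))
        with (s * (Cmod (z - w) ^ 2 * (s + d) ^ n) + d * (Cmod (z - w) ^ 2 * (s + d) ^ n)) by ring.
      apply Rplus_le_compat.
      * apply Rmult_le_compat; [exact P1| |exact Hz|exact IH]. now apply Rmult_le_pos.
      * apply Rmult_le_compat_l; [exact Hd|]. apply Rmult_le_compat_l; [exact P4|exact HT].
Qed.

(** Termwise differentiation: the remainders of the monomials sum up to
    [O(|z - w|^2)], so that the formal derivative series is the derivative at each [w]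
    of the disk of convergence. *)
Lemma analytic_derive (F : C -> C) (z0 : C) :
  analytic_at F z0 -> analytic_at (C_derive F) z0.
Proof.
  intros [a [r [Hr HF]]].
  exists (fun n => (INR (S n) * a (S n))%C), r. split; [exact Hr|].
  intros w Hw. apply (proj2 (is_pseries_C_iff _ _ _)).
  set (m := Cmod (w - z0)) in *.
  set (d := (r - m) / 4). assert (Hd : 0 < d) by (unfold d; lra).
  set (Rd := m + d).
  assert (Hm0 : 0 <= m) by apply Cmod_ge_0.
  assert (HFs : forall z, Cmod (z - z0) < r -> cseries (fun n => (a n * (z - z0) ^ n)%C) (F z)).
  { intros z Hz. apply (proj1 (is_pseries_C_iff _ _ _)). now apply HF. }
  assert (Hin : Cmod (z0 + (Rd + 2 * d)%R - z0) < r).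
  { replace (z0 + (Rd + 2 * d)%R - z0)%C with (RtoC (Rd + 2 * d)) by ring.
    rewrite Cmod_R, Rabs_right; unfold Rd, d; lra. }
  generalize (HFs _ Hin). replace (z0 + (Rd + 2 * d)%R - z0)%C with (RtoC (Rd + 2 * d)) by ring.
  intros Hs. assert (Hlt : 0 <= Rd + d < Rd + 2 * d) by (unfold Rd; lra).
  destruct (cpseries_abs_conv a _ _ _ Hlt Hs) as [B HB]. clear Hs Hin Hlt.
  destruct (cseries_of_abs (fun n => (a n * (INR n * (w - z0) ^ pred n))%C)
              (fun n => / d * (Cmod (a n) * (Rd + d) ^ n))) as [T HT].
  { intros n. rewrite Cmod_mult.
    assert (H := Cpow_deriv_bound (w - z0) Rd d n (Rlt_le _ _ Hd)).
    assert (Hw' : Cmod (w - z0) <= Rd) by (fold m; unfold Rd; lra). specialize (H Hw').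
    apply Rmult_le_reg_l with (1 := Hd).
    replace (d * (/ d * (Cmod (a n) * (Rd + d) ^ n))) with (Cmod (a n) * (Rd + d) ^ n)
      by (field; lra).
    replace (d * (Cmod (a n) * Cmod (INR n * (w - z0) ^ pred n)))
      with (Cmod (a n) * (Cmod (INR n * (w - z0) ^ pred n) * d)) by ring.
    apply Rmult_le_compat_l; [apply Cmod_ge_0|exact H]. }
  { apply (ex_series_scal_l (V := R_NormedModule) (/ d) (fun n => Cmod (a n) * (Rd + d) ^ n)). now exists B. }
  assert (HTw : cseries (fun n => (INR (S n) * a (S n) * (w - z0) ^ n)%C) T).
  { assert (H1 : cseries (fun n => (a (S n) * (INR (S n) * (w - z0) ^ n))%C) T).
    { replace T with (T - a 0%nat * (INR 0 * (w - z0) ^ pred 0))%C by (simpl; ring).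
      exact (cseries_incr_1 _ _ HT). }
    revert H1. apply is_series_ext. intros n.
    change ((a (S n) * (INR (S n) * (w - z0) ^ n))%C = (INR (S n) * a (S n) * (w - z0) ^ n)%C).
    ring. }
  assert (Hrem : forall z, Cmod (z - w) < d ->
            Cmod (F z - F w - (z - w) * T) * d ^ 2 <= Cmod (z - w) ^ 2 * B).
  { intros z Hz.
    assert (Hzm : Cmod (z - z0) <= Rd).
    { replace (z - z0)%C with ((z - w) + (w - z0))%C by ring.
      eapply Rle_trans; [apply Cmod_triangle|]. fold m. unfold Rd. lra. }
    assert (Hzr : Cmod (z - z0) < r) by (unfold Rd, d in Hzm; lra).
    assert (Hser : cseries (fun n => (d ^ 2)%R * (a n * ((z - z0) ^ n - (w - z0) ^ n
                - ((z - z0) - (w - z0)) * (INR n * (w - z0) ^ pred n))))%C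
              ((d ^ 2)%R * (F z - F w - (z - w) * T))%C).
    { apply (is_series_scal (V := C_NormedModule) (RtoC (d ^ 2))).
      generalize (is_series_minus (V := C_NormedModule) _ _ _ _
        (is_series_minus (V := C_NormedModule) _ _ _ _ (HFs z Hzr) (HFs w Hw))
        (is_series_scal (V := C_NormedModule) (z - w)%C _ _ HT)).
      apply is_series_ext. intros n.
      change ((a n * (z - z0) ^ n - a n * (w - z0) ^ n
         - (z - w) * (a n * (INR n * (w - z0) ^ pred n)))%C
         = (a n * ((z - z0) ^ n - (w - z0) ^ n
                - ((z - z0) - (w - z0)) * (INR n * (w - z0) ^ pred n)))%C). ring. }
    assert (Hd2 : 0 <= d ^ 2) by apply pow2_ge_0.
    replace (Cmod (F z - F w - (z - w) * T) * d ^ 2)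
      with (Cmod ((d ^ 2)%R * (F z - F w - (z - w) * T))).
    2:{ rewrite Cmod_mult, Cmod_R, Rabs_right by lra. ring. }
    refine (cseries_Cmod_le _ (fun n => Cmod (z - w) ^ 2 * (Cmod (a n) * (Rd + d) ^ n))
              _ _ Hser (is_series_scal (V := R_NormedModule) _ _ _ HB) _).
    intros n. rewrite !Cmod_mult, Cmod_R, Rabs_right by lra.
    assert (H := Cpow_taylor_bound (z - z0) (w - z0) Rd d n (Rlt_le _ _ Hd) Hzm).
    assert (Hw' : Cmod (w - z0) <= Rd) by (fold m; unfold Rd; lra). specialize (H Hw').
    replace (Cmod (z - w)) with (Cmod ((z - z0) - (w - z0))) by (f_equal; ring).
    set (X := Cmod ((z - z0) ^ n - (w - z0) ^ n
                - ((z - z0) - (w - z0)) * (INR n * (w - z0) ^ pred n))) in *.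
    replace (d ^ 2 * (Cmod (a n) * X)) with (Cmod (a n) * (X * d ^ 2)) by ring.
    replace (Cmod (z - z0 - (w - z0)) ^ 2 * (Cmod (a n) * (Rd + d) ^ n))
      with (Cmod (a n) * (Cmod (z - z0 - (w - z0)) ^ 2 * (Rd + d) ^ n)) by ring.
    apply Rmult_le_compat_l; [apply Cmod_ge_0|exact H]. }
  replace (C_derive F w) with T; [exact HTw|]. symmetry.
  set (G := fun z => if Ceq_dec z w then T else ((F z - F w) / (z - w))%C).
  assert (Gw : G w = T) by (unfold G; destruct (Ceq_dec w w); [reflexivity|contradiction]).
  rewrite <- Gw. apply C_derive_of_slope.
  - apply filter_forall. intros z. unfold G. destruct (Ceq_dec z w) as [->|Hne].
    + assert (E : F w = (F w + (w - w) * T)%C) by ring. exact E.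
    + assert (E : F z = (F w + (z - w) * ((F z - F w) / (z - w)))%C).
      { field. now apply Cminus_eq_contra. }
      exact E.
  - assert (B0 : 0 <= B).
    { assert (0 <= Cmod (d / 2)%R ^ 2 * B).
      { eapply Rle_trans; [|replace (RtoC (d / 2)) with ((w + (d / 2)%R) - w)%C by ring; apply Hrem].
        - apply Rmult_le_pos; [apply Cmod_ge_0|apply pow2_ge_0].
        - replace (w + (d / 2)%R - w)%C with (RtoC (d / 2)) by ring.
          rewrite Cmod_R, Rabs_right; lra. }
      rewrite Cmod_R, Rabs_right in H by lra. assert (0 < (d / 2) ^ 2) by (apply pow_lt; lra).
      apply Rmult_le_reg_l with ((d / 2) ^ 2); lra. }
    apply continuous_CU_iff. intros eps Heps. apply near_C_iff.
    exists (Rmin d (eps * d ^ 2 / (B + 1))). assert (Hd2 : 0 < d ^ 2) by nra. split.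
    { apply Rmin_pos; [lra|]. apply Rdiv_lt_0_compat; nra. }
    intros z Hz. rewrite Gw. unfold G. destruct (Ceq_dec z w) as [->|Hne].
    { replace (T - T)%C with (RtoC 0) by ring. now rewrite Cmod_0. }
    assert (Hz1 : Cmod (z - w) < d) by (eapply Rlt_le_trans; [exact Hz|apply Rmin_l]).
    assert (Hz2 : Cmod (z - w) < eps * d ^ 2 / (B + 1))
      by (eapply Rlt_le_trans; [exact Hz|apply Rmin_r]).
    assert (Hzw : (z - w)%C <> 0) by now apply Cminus_eq_contra.
    assert (Hp : 0 < Cmod (z - w)) by now apply Cmod_gt_0.
    replace ((F z - F w) / (z - w) - T)%C with ((F z - F w - (z - w) * T) / (z - w))%C
      by now field.
    rewrite Cmod_div by exact Hzw.
    apply Rmult_lt_reg_r with (Cmod (z - w) * d ^ 2); [nra|].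
    replace (Cmod (F z - F w - (z - w) * T) / Cmod (z - w) * (Cmod (z - w) * d ^ 2))
      with (Cmod (F z - F w - (z - w) * T) * d ^ 2) by (field; lra).
    eapply Rle_lt_trans; [now apply Hrem|].
    apply Rmult_lt_compat_r with (r := B + 1) in Hz2; [|lra].
    unfold Rdiv in Hz2. rewrite Rmult_assoc, Rinv_l, Rmult_1_r in Hz2 by lra. nra.
Qed.

(** * Growth and covering for harmonic mappings *)

Lemma le_of_derive_nonneg (f df : R -> R) (a b : R) :
  a <= b -> (forall t, a <= t <= b -> is_derive f t (df t)) ->
  (forall t, a <= t <= b -> 0 <= df t) -> f a <= f b.
Proof.
  intros Hab Hf Hdf. destruct (Rle_lt_or_eq_dec _ _ Hab) as [Hlt| ->]; [|lra].
  destruct (MVT_cor2 f df a b Hlt) as [c [Hc1 Hc2]].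
  { intros c Hc. apply is_derive_Reals. now apply Hf. }
  assert (0 <= df c * (b - a)) by (apply Rmult_le_pos; [apply Hdf|]; lra). lra.
Qed.

(** With [v = 1] and [v = - Ci] this gives the real and the imaginary part of [F]. *)
Lemma is_derive_along_line (F : C -> C) (u v : C) (t0 : R) :
  expandable 1 F (t0 * u)%C ->
  is_derive (fun t : R => Re (v * F (t * u)%C)) t0 (Re (v * (u * C_derive F (t0 * u)%C))).
Proof.
  intros HF. apply expandable_derive_slope in HF. destruct HF as [G [<- [HG HF]]].
  apply is_derive_Reals. intros eps Heps.
  set (m := Cmod v * Cmod u + 1).
  assert (Hm : 0 < m).
  { unfold m. generalize (Rmult_le_pos _ _ (Cmod_ge_0 v) (Cmod_ge_0 u)). lra. }
  assert (Hem : 0 < eps / m) by now apply Rdiv_lt_0_compat.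
  generalize (filter_and _ _ HF (proj1 (continuous_CU_iff G _) HG _ Hem)). intros H.
  apply near_C_iff in H. destruct H as [d [Hd H]].
  assert (Hu : 0 < Cmod u + 1) by (generalize (Cmod_ge_0 u); lra).
  assert (Hdu : 0 < d / (Cmod u + 1)) by now apply Rdiv_lt_0_compat.
  exists (mkposreal _ Hdu). intros h Hh0 Hh. simpl in Hh.
  assert (E0 : ((t0 + h)%R * u - t0 * u)%C = (h * u)%C) by (rewrite RtoC_plus; ring).
  assert (Hz : Cmod ((t0 + h)%R * u - t0 * u) < d).
  { rewrite E0, Cmod_mult, Cmod_R.
    apply Rmult_lt_compat_r with (r := Cmod u + 1) in Hh; [|exact Hu].
    unfold Rdiv in Hh. rewrite Rmult_assoc, Rinv_l, Rmult_1_r in Hh by lra.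
    generalize (Rabs_pos h) (Cmod_ge_0 u). nra. }
  destruct (H _ Hz) as [E1 E2]. rewrite E1, E0.
  set (z := ((t0 + h)%R * u)%C) in *. set (z0 := (t0 * u)%C) in *.
  replace ((Re (v * (F z0 + h * u * G z)) - Re (v * F z0)) / h - Re (v * (u * G z0)))
    with (Re (v * u * (G z - G z0))).
  2:{ replace (v * (F z0 + h * u * G z))%C with (v * F z0 + h * (v * u * G z))%C by ring.
      rewrite re_plus, re_scal_l.
      replace (v * u * (G z - G z0))%C with (v * u * G z + - (v * (u * G z0)))%C by ring.
      rewrite re_plus, re_opp. field. exact Hh0. }
  eapply Rle_lt_trans; [apply re_le_Cmod|]. rewrite !Cmod_mult.
  apply Rmult_lt_compat_r with (r := m) in E2; [|exact Hm].
  unfold Rdiv in E2. rewrite Rmult_assoc, Rinv_l, Rmult_1_r in E2 by lra.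
  generalize (Cmod_ge_0 (G z - G z0)). unfold m in E2. nra.
Qed.

Lemma is_derive_Cmod_sqr_along_line (F : C -> C) (u : C) (t0 : R) :
  expandable 1 F (t0 * u)%C ->
  is_derive (fun t : R => Cmod (F (t * u)%C) ^ 2) t0
    (2 * Re (u * (C_derive F (t0 * u)%C * Cconj (F (t0 * u)%C)))).
Proof.
  intros HF.
  generalize (is_derive_along_line F u 1 t0 HF) (is_derive_along_line F u (- Ci) t0 HF).
  intros H1 H2.
  apply (is_derive_ext (fun t : R => Re (1 * F (t * u)%C) ^ 2 + Re (- Ci * F (t * u)%C) ^ 2)).
  { intros t. rewrite Cmod2_alt. destruct (F (t * u)%C) as [x y].
    unfold Re, Im, Ci, Cmult, Copp, RtoC; simpl. ring. }
  evar_last.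
  { apply (is_derive_plus (V := R_NormedModule));
      apply (is_derive_pow _ 2); eassumption. }
  unfold plus; simpl.
  destruct (F (t0 * u)%C) as [x y], (C_derive F (t0 * u)%C) as [p q], u as [a b].
  unfold Re, Im, Ci, Cmult, Copp, Cconj, RtoC; simpl. ring.
Qed.

Lemma Cconj_RtoC (x : R) : Cconj x = x.
Proof. unfold Cconj, RtoC; simpl. f_equal. ring. Qed.

Definition smooth_on_disk (F : C -> C) : Prop :=
  forall z, Cmod z < 1 -> expandable 1 F z.

Lemma unit_direction (z : C) : exists u : C, Cmod u = 1 /\ z = (Cmod z * u)%C.
Proof.
  destruct (Ceq_dec z 0) as [->|Hz].
  - exists 1%C. split; [apply Cmod_1|]. rewrite Cmod_0. ring.
  - assert (Hp : 0 < Cmod z) by now apply Cmod_gt_0.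
    assert (Hpc : RtoC (Cmod z) <> 0) by (intros E; apply RtoC_inj in E; lra).
    exists (z / Cmod z)%C. split.
    + rewrite Cmod_div, Cmod_R, Rabs_right by (exact Hpc || lra). field. lra.
    + field. exact Hpc.
Qed.

Lemma Cmod_real_unit (t : R) (u : C) : 0 <= t -> Cmod u = 1 -> Cmod (t * u) = t.
Proof. intros Ht Hu. rewrite Cmod_mult, Hu, Cmod_R, Rabs_right; lra. Qed.

(** For a fixed [z], the modulus on the left is the real part of [conj e * (A + conj B)]
    with a constant unimodular [e]; along the radius through [z] the derivative of
    that real function is at most [|A'| + |B'|]. *)
Lemma growth (A B : C -> C) (m M : R -> R) :
  smooth_on_disk A -> smooth_on_disk B -> A 0 = 0 -> B 0 = 0 ->
  (forall z, Cmod z < 1 -> Cmod (C_derive A z) + Cmod (C_derive B z) <= m (Cmod z)) ->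
  (forall t, 0 <= t < 1 -> is_derive M t (m t)) ->
  forall z, Cmod z < 1 -> Cmod (A z + Cconj (B z)) <= M (Cmod z) - M 0.
Proof.
  intros HA HB A0 B0 Hm HM z Hz.
  destruct (unit_direction z) as [u [Hu Ez]].
  destruct (unit_direction (A z + Cconj (B z))) as [e [He Ew]].
  set (r := Cmod z) in *. assert (Hr : 0 <= r) by apply Cmod_ge_0.
  assert (Hin : forall t, 0 <= t <= r -> Cmod (t * u) = t) by (intros; apply Cmod_real_unit; [lra|exact Hu]).
  pose (D := fun t : R => m t - (Re (Cconj e * (u * C_derive A (t * u)%C))
                            + Re (e * (u * C_derive B (t * u)%C)))).
  assert (Hmono := le_of_derive_nonneg
    (fun t => M t - (Re (Cconj e * A (t * u)%C) + Re (e * B (t * u)%C))) D 0 r Hr).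
  cbv beta in Hmono.
  assert (Hle : M 0 - (Re (Cconj e * A (0 * u)%C) + Re (e * B (0 * u)%C))
                <= M r - (Re (Cconj e * A (r * u)%C) + Re (e * B (r * u)%C))).
  { apply Hmono.
    - intros t Ht. unfold D.
      apply (is_derive_minus (V := R_NormedModule)); [apply HM; lra|].
      apply (is_derive_plus (V := R_NormedModule)); apply is_derive_along_line;
        [apply HA|apply HB]; rewrite Hin; lra.
    - intros t Ht. unfold D.
      assert (Hmt : Cmod (C_derive A (t * u)%C) + Cmod (C_derive B (t * u)%C) <= m t).
      { rewrite <- (Hin t Ht) at 3. apply Hm. rewrite Hin; lra. }
      assert (Q : forall c w : C, Cmod c = 1 -> Re (c * (u * w)) <= Cmod w).
      { intros c w Hc. eapply Rle_trans; [apply Rle_abs|].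
        eapply Rle_trans; [apply re_le_Cmod|]. rewrite !Cmod_mult, Hc, Hu. lra. }
      generalize (Q (Cconj e) (C_derive A (t * u)%C) ltac:(now rewrite Cmod_conj))
                 (Q e (C_derive B (t * u)%C) He). lra. }
  rewrite <- Ez in Hle.
  replace (0 * u)%C with (RtoC 0) in Hle by ring. rewrite A0, B0 in Hle.
  replace (Cconj e * 0)%C with (RtoC 0) in Hle by ring.
  replace (e * 0)%C with (RtoC 0) in Hle by ring. rewrite re_RtoC in Hle.
  assert (E : Re (Cconj e * A z) + Re (e * B z) = Cmod (A z + Cconj (B z))).
  { transitivity (Re (Cconj e * (A z + Cconj (B z)))).
    - destruct e, (A z), (B z). unfold Re, Cmult, Cplus, Cconj; simpl. ring.
    - set (n := Cmod (A z + Cconj (B z))) in *. rewrite Ew.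
      replace (Cconj e * (n * e))%C with (n * (e * Cconj e))%C by ring.
      rewrite <- Cmod2_conj, He, re_scal_l, re_RtoC. ring. }
  lra.
Qed.

(** Let [z0] minimise [|F z - w| + k P (|z|)] and suppose that [e = F z0 - w] is not
    [0].  A step [s zt] which the differential sends to [- s e] lowers the first term
    by [s |e| + o(s)], while the second grows by at most
    [k s |zt| p (|z0|) + o(s) <= k s |e| + o(s)], because
    [|zt| (|A'| - |B'|) <= |e|]; this contradicts minimality as [k < 1]. *)
Lemma harmonic_covering (A B : C -> C) (p P : R -> R) :
  smooth_on_disk A -> smooth_on_disk B -> A 0 = 0 -> B 0 = 0 -> P 0 = 0 ->
  (forall z, Cmod z < 1 -> p (Cmod z) <= Cmod (C_derive A z) - Cmod (C_derive B z)) ->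
  (forall t, 0 <= t < 1 -> 0 < p t) ->
  (forall t, -1 < t < 1 -> is_derive P t (p t)) ->
  forall (w : C) (rho : R), 0 <= rho < 1 -> Cmod w < P rho ->
  exists z, Cmod z < 1 /\ (A z + Cconj (B z))%C = w.
Proof.
  intros HA HB A0 B0 P0 Hp Hpos HP w rho Hrho Hw.
  assert (HPr : 0 < P rho) by (generalize (Cmod_ge_0 w); lra).
  set (k := (Cmod w / P rho + 1) / 2).
  assert (Hwk : 0 <= Cmod w / P rho < 1).
  { split; [apply Rdiv_le_0_compat; [apply Cmod_ge_0|exact HPr]|].
    apply Rmult_lt_reg_r with (1 := HPr). unfold Rdiv.
    rewrite Rmult_assoc, Rinv_l, Rmult_1_l, Rmult_1_r by lra. exact Hw. }
  assert (Hk : 0 < k < 1) by (unfold k; lra).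
  assert (HkP : Cmod w < k * P rho).
  { assert (Hkk : Cmod w / P rho < k) by (unfold k; lra).
    apply Rmult_lt_compat_r with (r := P rho) in Hkk; [|exact HPr].
    unfold Rdiv in Hkk. rewrite Rmult_assoc, Rinv_l, Rmult_1_r in Hkk by lra. exact Hkk. }
  assert (Hmono : forall s t, 0 <= s <= t -> t < 1 -> P s <= P t).
  { intros s t Hst Ht. apply le_of_derive_nonneg with p; [lra| |].
    - intros x Hx. apply HP. lra.
    - intros x Hx. apply Rlt_le, Hpos. lra. }
  set (F := fun z => (A z + Cconj (B z))%C).
  (* a minimiser of this functional is a preimage of w *)
  destruct (attains_max (fun z => - (Cmod (F z - w) + k * P (Cmod z))) rho) as [z0 [Hz0 Hmin]].
  { lra. }
  { intros z Hz. assert (Hz1 : Cmod z < 1) by lra.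
    apply (continuous_opp (U := CU) (V := R_NormedModule)).
    apply (continuous_plus (U := CU) (V := R_NormedModule) (fun z => Cmod (F z - w))
             (fun z => k * P (Cmod z))).
    - apply (continuous_Cmod (fun z => F z - w)%C).
      apply continuous_Cplus; [|apply continuous_Cconst].
      apply continuous_Cplus; [now apply (expandable_continuous 1), HA|].
      apply continuous_CU_iff. intros eps Heps.
      generalize (proj1 (continuous_CU_iff B z) (expandable_continuous 1 _ _ (HB z Hz1)) eps Heps).
      apply filter_imp. intros y Hy. now rewrite <- Cminus_conj, Cmod_conj.
    - apply (continuous_mult (U := CU) (K := R_AbsRing) (fun _ => k) (fun z => P (Cmod z))).
      + apply (continuous_const (U := CU) (V := R_UniformSpace)).
      + apply (continuous_comp (U := CU) (V := R_UniformSpace) (W := R_UniformSpace) Cmod P).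
        * apply (continuous_Cmod (fun z => z)), continuous_Cid.
        * apply (ex_derive_continuous (V := R_NormedModule)). exists (p (Cmod z)).
          apply HP. generalize (Cmod_ge_0 z). lra. }
  set (r := Cmod z0) in *. assert (Hr0 : 0 <= r) by apply Cmod_ge_0.
  assert (Hrlt : r < rho).
  { assert (H0 : Cmod 0 <= rho) by (rewrite Cmod_0; lra).
    specialize (Hmin 0 H0). unfold F in Hmin. rewrite A0, B0, Cmod_0, P0 in Hmin.
    replace (0 + Cconj 0 - w)%C with (- w)%C in Hmin.
    2:{ destruct w. unfold Cconj, Cminus, Cplus, Copp, RtoC; simpl. f_equal; ring. }
    rewrite Cmod_opp in Hmin.
    assert (Hkr : k * P r < k * P rho).
    { generalize (Cmod_ge_0 (A z0 + Cconj (B z0) - w)). lra. }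
    apply Rnot_le_lt. intros Hge. generalize (Hmono rho r ltac:(lra) ltac:(lra)). nra. }
  exists z0. split; [fold r; lra|]. fold (F z0).
  apply NNPP. intros Hne. exfalso.
  set (e := (F z0 - w)%C).
  assert (He : 0 < Cmod e) by (apply Cmod_gt_0; now apply Cminus_eq_contra).
  assert (Hz01 : Cmod z0 < 1) by (fold r; lra).
  destruct (expandable_derive_slope 0 A z0 (HA z0 Hz01)) as [GA [EA [CA SA]]].
  destruct (expandable_derive_slope 0 B z0 (HB z0 Hz01)) as [GB [EB [CB SB]]].
  specialize (Hp z0 Hz01). fold r in Hp. rewrite <- EA, <- EB in Hp.
  set (al := GA z0) in *. set (be := GB z0) in *.
  assert (Hpr : 0 < p r) by (apply Hpos; lra).
  (* direction in which the differential of F moves F z0 straight towards w *)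
  set (Dl := Cmod al ^ 2 - Cmod be ^ 2).
  assert (HDl : Dl = (Cmod al - Cmod be) * (Cmod al + Cmod be)) by (unfold Dl; ring).
  assert (Hal : 0 < Cmod al + Cmod be) by (generalize (Cmod_ge_0 al) (Cmod_ge_0 be); lra).
  assert (HDl0 : 0 < Dl) by (rewrite HDl; apply Rmult_lt_0_compat; lra).
  assert (HDlC : RtoC Dl <> 0) by (intros E; apply RtoC_inj in E; lra).
  set (zt := (- (Cconj al * e - Cconj be * Cconj e) / Dl)%C).
  assert (HDlE : RtoC Dl = (al * Cconj al - be * Cconj be)%C).
  { unfold Dl. now rewrite RtoC_minus, !Cmod2_conj. }
  assert (Hczt : Cconj zt = (- (al * Cconj e - be * e) / Dl)%C).
  { unfold zt. rewrite Cdiv_conj, Copp_conj, Cminus_conj, !Cmult_conj, !Cconj_conj by exact HDlC.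
    now rewrite Cconj_RtoC. }
  assert (Hzt : (al * zt + Cconj (be * zt))%C = (- e)%C).
  { rewrite Cmult_conj, Hczt. unfold zt.
    transitivity (- e * (al * Cconj al - be * Cconj be) / Dl)%C.
    - field. exact HDlC.
    - rewrite <- HDlE. field. exact HDlC. }
  assert (Hzn : 0 < Cmod zt).
  { apply Cmod_gt_0. intros E. rewrite E in Hzt.
    assert (E2 : Cmod (- e) = 0).
    { rewrite <- Hzt, !Cmult_0_r, Cconj_RtoC, Cplus_0_l. apply Cmod_0. }
    rewrite Cmod_opp in E2. lra. }
  assert (Hzle : Cmod zt * p r <= Cmod e).
  { assert (E1 : Cmod zt * Dl <= (Cmod al + Cmod be) * Cmod e).
    { replace (Cmod zt * Dl) with (Cmod (zt * Dl)).
      2:{ rewrite Cmod_mult, Cmod_R, Rabs_right; lra. }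
      replace (zt * Dl)%C with (- (Cconj al * e) + Cconj be * Cconj e)%C.
      2:{ unfold zt. field. exact HDlC. }
      eapply Rle_trans; [apply Cmod_triangle|].
      rewrite Cmod_opp, !Cmod_mult, !Cmod_conj. lra. }
    rewrite HDl in E1.
    assert (E2 : Cmod zt * (Cmod al - Cmod be) <= Cmod e).
    { apply Rmult_le_reg_l with (1 := Hal). lra. }
    nra. }
  (* three error terms, each at most h * eta, add up to half of the gain (1 - k) * s * |e| *)
  set (eta := (1 - k) * p r / 6).
  assert (Heta : 0 < eta) by (unfold eta; nra).
  generalize (filter_and _ _ (filter_and _ _ SA (proj1 (continuous_CU_iff GA z0) CA _ Heta))
                (filter_and _ _ SB (proj1 (continuous_CU_iff GB z0) CB _ Heta))).
  intros H. apply near_C_iff in H. destruct H as [d [Hd H]].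
  assert (HdP : is_derive P r (p r)) by (apply HP; lra).
  apply is_derive_Reals in HdP. destruct (HdP eta Heta) as [dP HdP2].
  set (h := Rmin (Rmin dP d) (Rmin (rho - r) (Cmod zt)) / 2).
  assert (Hh : 0 < h /\ h < dP /\ h < d /\ h < rho - r /\ h < Cmod zt).
  { assert (Hmn : 0 < Rmin (Rmin dP d) (Rmin (rho - r) (Cmod zt))).
    { repeat apply Rmin_pos; try lra. apply cond_pos. }
    generalize (Rmin_l (Rmin dP d) (Rmin (rho - r) (Cmod zt)))
      (Rmin_r (Rmin dP d) (Rmin (rho - r) (Cmod zt))) (Rmin_l dP d) (Rmin_r dP d)
      (Rmin_l (rho - r) (Cmod zt)) (Rmin_r (rho - r) (Cmod zt)).
    unfold h. lra. }
  destruct Hh as [Hh0 [HhP [Hhd [Hhr Hhz]]]].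
  set (s := h / Cmod zt).
  assert (Hsz : s * Cmod zt = h) by (unfold s; field; lra).
  assert (Hs : 0 < s < 1).
  { split; [now apply Rdiv_lt_0_compat|].
    apply Rmult_lt_reg_r with (1 := Hzn). lra. }
  set (z1 := (z0 + s * zt)%C).
  assert (E1 : (z1 - z0)%C = (s * zt)%C) by (unfold z1; ring).
  assert (Hstep : Cmod (z1 - z0) = h).
  { rewrite E1, Cmod_mult, Cmod_R, Rabs_right; lra. }
  destruct (H z1 ltac:(lra)) as [[A1 A2] [B1 B2]].
  assert (Hz1r : Cmod z1 <= r + h).
  { generalize (Cmod_triangle_minus z1 z0). fold r. lra. }
  assert (HP1 : P (Cmod z1) <= P r + h * (p r + eta)).
  { apply Rle_trans with (P (r + h)).
    - apply Hmono; [split; [apply Cmod_ge_0|exact Hz1r]|lra].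
    - assert (Hh1 : h <> 0) by lra.
      assert (Hh2 : Rabs h < dP) by (rewrite Rabs_right; lra).
      specialize (HdP2 h Hh1 Hh2). apply Rabs_lt_between in HdP2.
      assert (E2 : (P (r + h) - P r) / h <= p r + eta) by lra.
      apply Rmult_le_compat_l with (r := h) in E2; [|lra].
      replace (h * ((P (r + h) - P r) / h)) with (P (r + h) - P r) in E2 by (field; lra).
      lra. }
  assert (HF1 : Cmod (F z1 - w) <= (1 - s) * Cmod e + 2 * h * eta).
  { assert (E2 : (F z1 - w)%C = ((1 - s)%R * e
        + (s * zt * (GA z1 - GA z0) + Cconj (s * zt * (GB z1 - GB z0))))%C).
    { unfold F. rewrite A1, B1, E1.
      assert (E3 : ((1 - s)%R * e)%C = (e + s * (al * zt + Cconj (be * zt)))%C).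
      { rewrite Hzt, RtoC_minus. ring. }
      rewrite E3. unfold e, F, al, be.
      rewrite !Cplus_conj, !Cmult_conj, Cminus_conj, Cconj_RtoC. ring. }
    rewrite E2. eapply Rle_trans; [apply Cmod_triangle|].
    apply Rplus_le_compat.
    - rewrite Cmod_mult, Cmod_R, Rabs_right; lra.
    - eapply Rle_trans; [apply Cmod_triangle|].
      rewrite Cmod_conj, !Cmod_mult, Cmod_R, Rabs_right by lra. rewrite Hsz.
      nra. }
  assert (Hz1rho : Cmod z1 <= rho) by lra.
  specialize (Hmin z1 Hz1rho). fold e in Hmin.
  assert (Hhp : h * p r <= s * Cmod e).
  { rewrite <- Hsz, Rmult_assoc. apply Rmult_le_compat_l; lra. }
  assert (Hheta : h * eta <= (1 - k) / 6 * (s * Cmod e)).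
  { unfold eta. replace (h * ((1 - k) * p r / 6)) with ((1 - k) / 6 * (h * p r)) by field.
    apply Rmult_le_compat_l; lra. }
  assert (Hse : 0 < s * Cmod e) by nra.
  assert (HkP1 : k * P (Cmod z1) <= k * P r + k * (h * (p r + eta))) by nra.
  assert (Hhe : 0 <= h * eta) by nra.
  assert (Hke : k * (h * eta) <= h * eta) by nra.
  assert (Hkp : k * (h * p r) <= k * (s * Cmod e)) by nra.
  assert (Hfin : 0 < (1 - k) * (s * Cmod e)) by nra.
  nra.
Qed.

(** * Distortion *)

Lemma analytic_smooth (F : C -> C) : analytic_on_disk F -> smooth_on_disk F.
Proof. intros HF z Hz. now apply analytic_expandable, HF. Qed.

(** The pre-Schwarzian derivative is the logarithmic [z]-derivative of the Jacobian. *)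
Lemma jacobian_is_derive (f : harmonic_mapping) (u : C) (t : R) :
  sense_preserving f -> Cmod (t * u) < 1 ->
  is_derive (fun t : R => jacobian f (t * u)%C) t
    (jacobian f (t * u)%C * (2 * Re (u * preschwarzian f (t * u)%C))).
Proof.
  intros Hsp Hz. set (z := (t * u)%C) in *.
  assert (HJ : 0 < jacobian f z) by now apply Hsp.
  assert (HJC : RtoC (jacobian f z) <> 0) by (intros E; apply RtoC_inj in E; lra).
  assert (Hh : expandable 1 (C_derive (hol_part f)) z)
    by now apply analytic_expandable, analytic_derive, hol_part_analytic.
  assert (Hg : expandable 1 (C_derive (antihol_part f)) z)
    by now apply analytic_expandable, analytic_derive, antihol_part_analytic.
  evar_last.
  { apply (is_derive_minus (V := R_NormedModule));
      apply is_derive_Cmod_sqr_along_line; [exact Hh|exact Hg]. }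
  fold z. unfold preschwarzian.
  set (h1 := C_derive (hol_part f) z). set (g1 := C_derive (antihol_part f) z).
  set (h2 := C_derive (C_derive (hol_part f)) z).
  set (g2 := C_derive (C_derive (antihol_part f)) z).
  set (J := jacobian f z) in *.
  change (2 * Re (u * (h2 * Cconj h1)) - 2 * Re (u * (g2 * Cconj g1))
    = J * (2 * Re (u * ((h2 * Cconj h1 - g2 * Cconj g1) / J)))).
  rewrite <- Rmult_assoc, (Rmult_comm J 2), Rmult_assoc, <- (re_scal_l J).
  replace (J * (u * ((h2 * Cconj h1 - g2 * Cconj g1) / J)))%C
    with (u * (h2 * Cconj h1) + - (u * (g2 * Cconj g1)))%C by (field; exact HJC).
  rewrite re_plus, re_opp. ring.
Qed.

Lemma preschwarzian_bound (lam : R) (f : harmonic_mapping) (z : C) :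
  Rbar_le (preschwarzian_norm f) lam -> Cmod z < 1 ->
  (1 - Cmod z ^ 2) * Cmod (preschwarzian f z) <= lam.
Proof.
  intros Hn Hz.
  assert (H : Rbar_le ((1 - Cmod z ^ 2) * Cmod (preschwarzian f z)) (preschwarzian_norm f)).
  { apply (proj1 (Lub_Rbar_correct _)). exists z. split; [exact Hz|reflexivity]. }
  exact (Rbar_le_trans _ _ _ H Hn).
Qed.

(** The distance from [0] to [r] in the hyperbolic metric [2 |dz| / (1 - |z|^2)] of
    curvature [-1]. *)
Definition hyp_dist (r : R) : R := ln (1 + r) - ln (1 - r).

Lemma is_derive_hyp_dist (t : R) : -1 < t < 1 -> is_derive hyp_dist t (2 / (1 - t ^ 2)).
Proof.
  intros Ht. unfold hyp_dist. auto_derive; [lra|]. field. nra.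
Qed.

(** Along a radius [ln J - lam * hyp_dist] decreases and [ln J + lam * hyp_dist]
    increases, both by the bound on the pre-Schwarzian derivative. *)
Lemma jacobian_bounds (lam : R) (f : harmonic_mapping) (z : C) :
  sense_preserving f -> Rbar_le (preschwarzian_norm f) lam -> Cmod z < 1 ->
  jacobian f 0 * exp (- (lam * hyp_dist (Cmod z))) <= jacobian f z
    <= jacobian f 0 * exp (lam * hyp_dist (Cmod z)).
Proof.
  intros Hsp Hn Hz.
  destruct (unit_direction z) as [u [Hu Ez]]. set (r := Cmod z) in *.
  assert (Hr : 0 <= r) by apply Cmod_ge_0.
  assert (Hin : forall t, 0 <= t <= r -> Cmod (t * u) = t)
    by (intros; apply Cmod_real_unit; [lra|exact Hu]).
  assert (Hpos : forall t, 0 <= t <= r -> 0 < jacobian f (t * u)%C)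
    by (intros t Ht; apply Hsp; unfold unit_disk; rewrite Hin; lra).
  assert (HL : forall t, 0 <= t <= r ->
     is_derive (fun t : R => ln (jacobian f (t * u)%C)) t (2 * Re (u * preschwarzian f (t * u)%C))).
  { intros t Ht. generalize (Hpos t Ht). intros HJ.
    evar_last.
    { apply (is_derive_comp (V := R_NormedModule) ln (fun t : R => jacobian f (t * u)%C)).
      - apply is_derive_ln. exact HJ.
      - apply jacobian_is_derive; [exact Hsp|]. rewrite Hin; lra. }
    unfold scal; simpl. unfold mult; simpl. field. lra. }
  assert (HP : forall t, 0 <= t <= r ->
     Rabs (2 * Re (u * preschwarzian f (t * u)%C)) <= lam * (2 / (1 - t ^ 2))).
  { intros t Ht. rewrite Rabs_mult, (Rabs_right 2) by lra.
    assert (B : (1 - Cmod (t * u) ^ 2) * Cmod (preschwarzian f (t * u)%C) <= lam).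
    { apply preschwarzian_bound; [exact Hn|]. rewrite Hin; lra. }
    rewrite Hin in B by exact Ht.
    assert (B2 : Rabs (Re (u * preschwarzian f (t * u)%C)) <= Cmod (preschwarzian f (t * u)%C)).
    { eapply Rle_trans; [apply re_le_Cmod|]. rewrite Cmod_mult, Hu. lra. }
    assert (Ht2 : 0 < 1 - t ^ 2) by nra.
    apply Rmult_le_reg_r with (1 := Ht2).
    replace (lam * (2 / (1 - t ^ 2)) * (1 - t ^ 2)) with (2 * lam) by (field; lra).
    nra. }
  assert (HT0 : hyp_dist 0 = 0) by (unfold hyp_dist; rewrite Rplus_0_r, Rminus_0_r; lra).
  assert (E0 : (0 * u)%C = 0) by ring.
  assert (L1 : lam * hyp_dist 0 - ln (jacobian f (0 * u)%C)
               <= lam * hyp_dist r - ln (jacobian f (r * u)%C)).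
  { apply (le_of_derive_nonneg (fun t => lam * hyp_dist t - ln (jacobian f (t * u)%C))
      (fun t => lam * (2 / (1 - t ^ 2)) - 2 * Re (u * preschwarzian f (t * u)%C)) 0 r Hr).
    - intros t Ht. apply (is_derive_minus (V := R_NormedModule)); [|now apply HL].
      apply (is_derive_scal hyp_dist t lam), is_derive_hyp_dist. lra.
    - intros t Ht. generalize (proj1 (Rabs_le_between _ _) (HP t Ht)). lra. }
  assert (L2 : lam * hyp_dist 0 + ln (jacobian f (0 * u)%C)
               <= lam * hyp_dist r + ln (jacobian f (r * u)%C)).
  { apply (le_of_derive_nonneg (fun t => lam * hyp_dist t + ln (jacobian f (t * u)%C))
      (fun t => lam * (2 / (1 - t ^ 2)) + 2 * Re (u * preschwarzian f (t * u)%C)) 0 r Hr).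
    - intros t Ht. apply (is_derive_plus (V := R_NormedModule)); [|now apply HL].
      apply (is_derive_scal hyp_dist t lam), is_derive_hyp_dist. lra.
    - intros t Ht. generalize (proj1 (Rabs_le_between _ _) (HP t Ht)). lra. }
  rewrite <- Ez, E0, HT0 in L1, L2.
  assert (J0 : 0 < jacobian f 0) by (rewrite <- E0; apply Hpos; lra).
  assert (Jz : 0 < jacobian f z) by (rewrite Ez; apply Hpos; lra).
  rewrite <- (exp_ln _ J0). rewrite <- (exp_ln _ Jz), <- !exp_plus.
  split; match goal with |- exp ?a <= exp ?b =>
         destruct (Rle_lt_or_eq_dec a b ltac:(lra)) as [Hlt|Heq];
         [left; now apply exp_increasing|rewrite Heq; lra] end.
Qed.

Lemma sense_preserving_derive_lt (f : harmonic_mapping) (z : C) :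
  sense_preserving f -> Cmod z < 1 ->
  Cmod (C_derive (antihol_part f) z) < Cmod (C_derive (hol_part f) z).
Proof.
  intros Hsp Hz. generalize (Hsp z Hz). unfold jacobian.
  generalize (Cmod_ge_0 (C_derive (antihol_part f) z)) (Cmod_ge_0 (C_derive (hol_part f) z)).
  nra.
Qed.

(** The Schwarz-Pick lemma for [g' / h'], cleared of denominators; at [0] this quotient
    is [g'(0)] since [h'(0) = 1]. *)
Lemma dilatation_bound (f : harmonic_mapping) (z : C) :
  class_H f -> Cmod z < 1 ->
  Cmod (C_derive (antihol_part f) z) * (1 + Cmod (C_derive (antihol_part f) 0) * Cmod z)
    <= (Cmod (C_derive (antihol_part f) 0) + Cmod z) * Cmod (C_derive (hol_part f) z).
Proof.
  intros [Hsp [_ [Hh1 _]]] Hz.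
  set (om := fun z => (C_derive (antihol_part f) z * / C_derive (hol_part f) z)%C).
  assert (Hnz : forall z, Cmod z < 1 -> C_derive (hol_part f) z <> 0).
  { intros y Hy. apply Cmod_gt_0.
    generalize (sense_preserving_derive_lt f y Hsp Hy) (Cmod_ge_0 (C_derive (antihol_part f) y)). lra. }
  assert (Hom : forall z, Cmod z < 1 ->
    Cmod (om z) * Cmod (C_derive (hol_part f) z) = Cmod (C_derive (antihol_part f) z)).
  { intros y Hy. rewrite <- Cmod_mult. f_equal. unfold om. field. now apply Hnz. }
  assert (Hom0 : om 0 = C_derive (antihol_part f) 0).
  { unfold om. rewrite Hh1. field. }
  assert (SP : Cmod (om z) * (1 + Cmod (om 0) * Cmod z) <= Cmod (om 0) + Cmod z).
  { apply schwarz_pick; [| |exact Hz].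
    - intros y Hy. unfold om. apply expandable_mult; [|apply expandable_inv; [now apply Hnz|]].
      + now apply analytic_expandable, analytic_derive, antihol_part_analytic.
      + now apply analytic_expandable, analytic_derive, hol_part_analytic.
    - intros y Hy. generalize (sense_preserving_derive_lt f y Hsp Hy). rewrite <- (Hom y Hy).
      generalize (Cmod_ge_0 (om y)) (Cmod_ge_0 (C_derive (hol_part f) y)). nra. }
  rewrite Hom0 in SP. rewrite <- (Hom z Hz).
  generalize (Cmod_ge_0 (C_derive (hol_part f) z)). nra.
Qed.

Lemma H_integrand_exp (a b t : R) :
  H_integrand a b t = exp (a * ln (1 + t) - b * ln (1 - t)).
Proof.
  unfold H_integrand, Rpower, Rdiv. rewrite <- exp_Ropp, <- exp_plus. f_equal. 
Qed.

Lemma H_integrand_pos (a b t : R) : 0 < H_integrand a b t.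
Proof. rewrite H_integrand_exp. apply exp_pos. Qed.

Lemma H_integrand_S (a b t : R) : -1 < t ->
  H_integrand (a + 1) b t = (1 + t) * H_integrand a b t.
Proof.
  intros Ht. rewrite !H_integrand_exp. rewrite <- (exp_ln (1 + t)) at 2 by lra.
  rewrite <- exp_plus. f_equal. ring.
Qed.

Lemma jacobian_0 (f : harmonic_mapping) :
  class_H f -> jacobian f 0 = 1 - Cmod (C_derive (antihol_part f) 0) ^ 2.
Proof. intros [_ [_ [Hh1 _]]]. unfold jacobian. rewrite Hh1, Cmod_1. ring. Qed.

Lemma b1_bounds (f : harmonic_mapping) :
  class_H f -> 0 <= Cmod (C_derive (antihol_part f) 0) < 1.
Proof.
  intros Hf. generalize (Cmod_ge_0 (C_derive (antihol_part f) 0)). intros H0.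
  split; [exact H0|].
  assert (J0 : 0 < jacobian f 0) by (apply Hf; unfold unit_disk; rewrite Cmod_0; lra).
  rewrite jacobian_0 in J0 by exact Hf. nra.
Qed.

(** What the distortion estimates use about a point [z]: [b = |g'(0)|], [r = |z|],
    [H = |h'(z)|], [G = |g'(z)|]. *)
Definition distortion_data (lam b r H G : R) : Prop :=
  0 <= b < 1 /\ 0 <= r < 1 /\ 0 <= G < H /\ G * (1 + b * r) <= (b + r) * H /\
  (1 - b ^ 2) * exp (- (lam * hyp_dist r)) <= H ^ 2 - G ^ 2
    <= (1 - b ^ 2) * exp (lam * hyp_dist r).

Lemma class_BH_distortion (lam : R) (f : harmonic_mapping) (z : C) :
  class_BH lam f -> Cmod z < 1 ->
  distortion_data lam (Cmod (C_derive (antihol_part f) 0)) (Cmod z)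
    (Cmod (C_derive (hol_part f) z)) (Cmod (C_derive (antihol_part f) z)).
Proof.
  intros [Hf Hn] Hz. split; [now apply b1_bounds|]. split; [|split; [split|split]].
  - split; [apply Cmod_ge_0|exact Hz].
  - apply Cmod_ge_0.
  - now apply sense_preserving_derive_lt; [apply Hf|].
  - now apply dilatation_bound.
  - rewrite <- jacobian_0 by exact Hf. now apply jacobian_bounds; [apply Hf| |].
Qed.

(** Eliminating [G] between the bound on [G / H] and the upper bound on [H^2 - G^2],
    with [(1 + b r)^2 - (b + r)^2 = (1 - b^2) (1 - r^2)]. *)
Lemma hol_derive_upper (lam b r H G : R) :
  distortion_data lam b r H G ->
  H <= (1 + b * r) * H_integrand ((lam - 1) / 2) ((lam + 1) / 2) r.
Proof.
  intros [Hb [Hr [HG [HW [_ HJ]]]]].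
  set (k := H_integrand _ _ r). assert (Hk : 0 < k) by apply H_integrand_pos.
  assert (Ek : k ^ 2 * (1 - r ^ 2) = exp (lam * hyp_dist r)).
  { replace (1 - r ^ 2) with ((1 + r) * (1 - r)) by ring.
    rewrite <- (exp_ln (1 + r)), <- (exp_ln (1 - r)) by lra. simpl pow. rewrite Rmult_1_r.
    unfold k. rewrite H_integrand_exp, !exp_ln, <- !exp_plus by lra.
    rewrite <- (exp_ln (1 + r)) at 3 by lra. rewrite <- (exp_ln (1 - r)) at 3 by lra.
    rewrite <- !exp_plus. f_equal. unfold hyp_dist. field. }
  rewrite <- Ek in HJ.
  apply pow2_le_inv; [apply Rmult_le_pos; nra|].
  assert (Hbr : 0 < 1 + b * r) by nra.
  assert (E1 : (G * (1 + b * r)) ^ 2 <= ((b + r) * H) ^ 2) by (apply pow_incr; split; [nra|exact HW]).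
  assert (E2 : (H ^ 2 - G ^ 2) * (1 + b * r) ^ 2
               <= (1 - b ^ 2) * (k ^ 2 * (1 - r ^ 2)) * (1 + b * r) ^ 2)
    by (apply Rmult_le_compat_r; [apply pow2_ge_0|exact HJ]).
  assert (E3 : H ^ 2 * ((1 - b ^ 2) * (1 - r ^ 2))
      <= ((1 + b * r) * k) ^ 2 * ((1 - b ^ 2) * (1 - r ^ 2))) by nra.
  assert (Hp : 0 < (1 - b ^ 2) * (1 - r ^ 2)) by (apply Rmult_lt_0_compat; nra).
  exact (Rmult_le_reg_r _ _ _ Hp E3).
Qed.

Lemma antihol_derive_upper (lam b r H G : R) :
  distortion_data lam b r H G ->
  G <= (b + r) * H_integrand ((lam - 1) / 2) ((lam + 1) / 2) r.
Proof.
  intros Hd. generalize (hol_derive_upper _ _ _ _ _ Hd). destruct Hd as [Hb [Hr [HG [HW _]]]].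
  set (k := H_integrand _ _ r). intros HH.
  assert (Hbr : 0 < 1 + b * r) by nra.
  apply Rmult_le_reg_r with (1 := Hbr).
  apply Rle_trans with (1 := HW). rewrite Rmult_assoc, (Rmult_comm k).
  apply Rmult_le_compat_l; lra.
Qed.

Lemma derive_sum_upper (lam b r H G : R) :
  distortion_data lam b r H G ->
  H + G <= (1 + b) * H_integrand ((lam + 1) / 2) ((lam + 1) / 2) r.
Proof.
  intros Hd. assert (Hr : 0 <= r) by apply Hd.
  replace (H_integrand ((lam + 1) / 2) ((lam + 1) / 2) r)
    with (H_integrand ((lam - 1) / 2 + 1) ((lam + 1) / 2) r) by (f_equal; field).
  rewrite H_integrand_S by lra.
  generalize (hol_derive_upper _ _ _ _ _ Hd) (antihol_derive_upper _ _ _ _ _ Hd). lra.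
Qed.

(** The bound on the Jacobian [H^2 - G^2] is also one on [H^2]. *)
Lemma hol_derive_lower (lam b r H G : R) :
  distortion_data lam b r H G ->
  sqrt (1 - b ^ 2) * H_integrand (lam / 2) (lam / 2) (- r) <= H.
Proof.
  intros [Hb [Hr [HG [HW [HJ _]]]]].
  apply pow2_le_inv; [lra|].
  rewrite Rpow_mult_distr, pow2_sqrt by nra.
  apply Rle_trans with (H ^ 2 - G ^ 2); [|nra].
  eapply Rle_trans; [|exact HJ]. right. f_equal.
  rewrite H_integrand_exp. simpl pow. rewrite Rmult_1_r, <- exp_plus. f_equal.
  unfold hyp_dist. replace (1 + - r) with (1 - r) by ring.
  replace (1 - - r) with (1 + r) by ring. field.
Qed.

(** [(H - G)^2] is the product of [H^2 - G^2] and [(H - G) / (H + G)]; the latter is at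
    least [((1 - b) (1 - r)) / ((1 + b) (1 + r))] by the bound on [G / H]. *)
Lemma derive_diff_lower (lam b r H G : R) :
  distortion_data lam b r H G ->
  (1 - b) * H_integrand ((lam + 1) / 2) ((lam + 1) / 2) (- r) <= H - G.
Proof.
  intros [Hb [Hr [HG [HW [HJ _]]]]].
  set (k := H_integrand _ _ _).
  assert (Ek : k ^ 2 * (1 + r) = (1 - r) * exp (- (lam * hyp_dist r))).
  { rewrite <- (exp_ln (1 + r)) at 1 by lra. rewrite <- (exp_ln (1 - r)) at 1 by lra.
    unfold k. rewrite H_integrand_exp. simpl pow. rewrite Rmult_1_r, <- !exp_plus. f_equal.
    unfold hyp_dist. replace (1 + - r) with (1 - r) by ring.
    replace (1 - - r) with (1 + r) by ring. field. }
  apply pow2_le_inv; [lra|].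
  set (X := exp (- (lam * hyp_dist r))) in *.
  assert (E1 : (H + G) * ((1 - b) * (1 - r)) <= (H - G) * ((1 + b) * (1 + r))) by nra.
  assert (E2 : (H - G) * ((H + G) * ((1 - b) * (1 - r))) <= (H - G) * ((H - G) * ((1 + b) * (1 + r))))
    by (apply Rmult_le_compat_l; lra).
  assert (E3 : (1 - b ^ 2) * X * ((1 - b) * (1 - r)) <= (H ^ 2 - G ^ 2) * ((1 - b) * (1 - r))).
  { apply Rmult_le_compat_r; [apply Rmult_le_pos; lra|exact HJ]. }
  assert (Hp : 0 < (1 + b) * (1 + r)) by (apply Rmult_lt_0_compat; lra).
  apply Rmult_le_reg_r with (1 := Hp).
  replace (((1 - b) * k) ^ 2 * ((1 + b) * (1 + r)))
    with ((1 - b) ^ 2 * (1 + b) * (k ^ 2 * (1 + r))) by ring.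
  rewrite Ek. lra.
Qed.

(** * The improper integrals *)

Definition values_on_01 (I : R -> R) (y : R) : Prop := exists t, 0 <= t < 1 /\ y = I t.

Lemma lub_limit_left (I : R -> R) (L : R) :
  (forall s t, 0 <= s <= t -> t < 1 -> I s <= I t) ->
  is_lub (values_on_01 I) L -> filterlim I (at_left 1) (locally L).
Proof.
  intros Hmono [Hub Hlub]. apply (filterlim_locally I L). intros eps.
  assert (Ht : exists t, 0 <= t < 1 /\ L - eps < I t).
  { apply NNPP. intros Hn.
    assert (Hle : L <= L - eps).
    { apply Hlub. intros y [t [Ht ->]]. apply Rnot_lt_le. intros Hlt. apply Hn. eauto. }
    generalize (cond_pos eps). lra. }
  destruct Ht as [t [Ht HLt]].
  apply (locally_interval _ 1 t p_infty); [simpl; lra|exact Logic.I|].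
  simpl. intros s Hs _ Hs1.
  assert (H1 : I t <= I s) by (apply Hmono; lra).
  assert (H2 : I s <= L) by (apply Hub; exists s; split; [lra|reflexivity]).
  unfold ball; simpl. unfold AbsRing_ball, abs, minus, plus, opp; simpl.
  apply Rabs_lt_between. generalize (cond_pos eps). lra.
Qed.

Lemma RInt_gen_of_limit (m I : R -> R) (Fb : (R -> Prop) -> Prop) (L : R) :
  ProperFilter Fb -> Fb (fun t => is_RInt m 0 t (I t)) -> filterlim I Fb (locally L) ->
  RInt_gen m (at_point 0) Fb = L.
Proof.
  intros HFb HI HL.
  apply (is_RInt_gen_unique (V := R_CompleteNormedModule)).
  intros Q HQ. unfold filtermapi.
  apply (Filter_prod _ _ _ (fun x => x = 0) (fun t => is_RInt m 0 t (I t) /\ Q (I t))).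
  - reflexivity.
  - apply filter_and; [exact HI|]. exact (HL Q HQ).
  - intros x t -> [H1 H2]. exists (I t). split; assumption.
Qed.

Lemma is_derive_RInt_0 (m : R -> R) :
  (forall t, -1 < t < 1 -> continuous m t) ->
  forall t, -1 < t < 1 -> is_RInt m 0 t (RInt m 0 t) /\ is_derive (RInt m 0) t (m t).
Proof.
  intros Hm.
  assert (HR : forall t, -1 < t < 1 -> is_RInt m 0 t (RInt m 0 t)).
  { intros t Ht. apply (RInt_correct (V := R_CompleteNormedModule)).
    apply (ex_RInt_continuous (V := R_CompleteNormedModule)). intros z Hz. apply Hm.
    revert Hz. unfold Rmin, Rmax. destruct (Rle_dec 0 t); lra. }
  intros t Ht. split; [now apply HR|].
  apply (is_derive_RInt (V := R_NormedModule) m (RInt m 0) 0 t); [|now apply Hm].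
  apply (locally_interval _ t (-1) 1); simpl; [lra|lra|]. intros s Hs1 Hs2. now apply HR.
Qed.

Lemma lub_values_exists (I : R -> R) (B : R) :
  (forall t, 0 <= t < 1 -> I t <= B) -> exists L, is_lub (values_on_01 I) L.
Proof.
  intros HB. destruct (completeness (values_on_01 I)) as [L HL].
  - exists B. intros y [t [Ht ->]]. now apply HB.
  - exists (I 0), 0. split; [lra|reflexivity].
  - now exists L.
Qed.

Lemma continuous_H_integrand (a b t : R) : -1 < t < 1 -> continuous (H_integrand a b) t.
Proof.
  intros Ht. apply (ex_derive_continuous (V := R_NormedModule)).
  apply (ex_derive_ext (fun t => exp (a * ln (1 + t) - b * ln (1 - t)))).
  - intros s. now rewrite H_integrand_exp.
  - auto_derive. lra.
Qed.

Definition H_primitive (a b : R) : R -> R := RInt (H_integrand a b) 0.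

Lemma H_primitive_0 (a b : R) : H_primitive a b 0 = 0.
Proof. unfold H_primitive. exact (RInt_point (V := R_CompleteNormedModule) 0 _). Qed.

Lemma is_derive_H_primitive (a b t : R) :
  -1 < t < 1 -> is_derive (H_primitive a b) t (H_integrand a b t).
Proof. apply is_derive_RInt_0. intros s. apply continuous_H_integrand. Qed.

Lemma H_primitive_incr (a b s t : R) :
  -1 < s <= t -> t < 1 -> H_primitive a b s <= H_primitive a b t.
Proof.
  intros Hs Ht. apply le_of_derive_nonneg with (H_integrand a b); [lra| |].
  - intros x Hx. apply is_derive_H_primitive. lra.
  - intros x Hx. apply Rlt_le, H_integrand_pos.
Qed.

(** The integrand is at most [2 (1 - t)^(- b)], which is integrable up to [1] since
    [b < 1].  Describing the improper integral as a supremum gives at once the estimate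
    of the partial integrals and their approximation of the total. *)
Lemma H_at_1_lub (a b : R) : a <= 1 -> b < 1 ->
  is_lub (values_on_01 (H_primitive a b)) (H_at_1 a b).
Proof.
  intros Ha Hb.
  set (K := fun t => - (2 / (1 - b)) * exp ((1 - b) * ln (1 - t))).
  assert (HK : forall t, 0 <= t < 1 -> is_derive K t (2 * exp (- b * ln (1 - t)))).
  { intros t Ht. unfold K. auto_derive; [lra|].
    replace ((1 - b) * ln (1 + - t)) with (ln (1 - t) + - b * ln (1 - t)).
    2:{ replace (1 + - t) with (1 - t) by ring. ring. }
    rewrite exp_plus, exp_ln by lra. field. lra. }
  destruct (lub_values_exists (H_primitive a b) (2 / (1 - b))) as [L HL].
  { intros t Ht.
    assert (Hle : K 0 - H_primitive a b 0 <= K t - H_primitive a b t).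
    { apply (le_of_derive_nonneg (fun t => K t - H_primitive a b t)
        (fun t => 2 * exp (- b * ln (1 - t)) - H_integrand a b t)); [lra| |].
      - intros s Hs. apply (is_derive_minus (V := R_NormedModule)); [apply HK; lra|].
        apply is_derive_H_primitive. lra.
      - intros s Hs. rewrite H_integrand_exp.
        assert (E : exp (a * ln (1 + s)) <= 2).
        { assert (L0 : 0 <= ln (1 + s)).
          { destruct (Rle_lt_or_eq_dec 0 s ltac:(lra)) as [Hp| <-].
            - left. rewrite <- ln_1. apply ln_increasing; lra.
            - rewrite Rplus_0_r, ln_1. lra. }
          apply Rle_trans with (exp (ln (1 + s))); [|rewrite exp_ln; lra].
          destruct (Rle_lt_or_eq_dec (a * ln (1 + s)) (ln (1 + s)) ltac:(nra)) as [Hlt| ->]; [|lra].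
          left. now apply exp_increasing. }
        replace (a * ln (1 + s) - b * ln (1 - s))
          with (a * ln (1 + s) + - b * ln (1 - s)) by ring.
        rewrite exp_plus.
        generalize (exp_pos (- b * ln (1 - s))). nra. }
    rewrite H_primitive_0 in Hle. unfold K in Hle.
    replace (ln (1 - 0)) with 0 in Hle by (rewrite Rminus_0_r, ln_1; reflexivity).
    rewrite Rmult_0_r, exp_0 in Hle.
    assert (0 < 2 / (1 - b)) by (apply Rdiv_lt_0_compat; lra).
    generalize (exp_pos ((1 - b) * ln (1 - t))). nra. }
  replace (H_at_1 a b) with L; [exact HL|]. symmetry.
  unfold H_at_1. apply (RInt_gen_of_limit _ (H_primitive a b)).
  - apply at_left_proper_filter.
  - apply (locally_interval _ 1 0 p_infty); [simpl; lra|exact Logic.I|].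
    simpl. intros s Hs _ Hs1.
    apply is_derive_RInt_0; [intros; now apply continuous_H_integrand|lra].
  - apply lub_limit_left; [|exact HL]. intros s t Hs Ht. apply H_primitive_incr; lra.
Qed.

(** For [t <= 0] the integrand is at most [1]. *)
Lemma H_at_m1_lub (a : R) : 0 <= a ->
  is_lub (values_on_01 (fun t => - H_primitive a a (- t))) (- H_at_m1 a a).
Proof.
  intros Ha.
  destruct (lub_values_exists (fun t => - H_primitive a a (- t)) 1) as [L HL].
  { intros t Ht.
    assert (Hle : - t - H_primitive a a (- t) <= 0 - H_primitive a a 0).
    { apply (le_of_derive_nonneg (fun t => t - H_primitive a a t)
        (fun t => 1 - H_integrand a a t)); [lra| |].
      - intros s Hs. apply (is_derive_minus (V := R_NormedModule) (fun t => t)).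
        + apply (is_derive_id (K := R_AbsRing)).
        + apply is_derive_H_primitive. lra.
      - intros s Hs. rewrite H_integrand_exp.
        assert (Hln : ln (1 + s) <= ln (1 - s)).
        { destruct (Rle_lt_or_eq_dec s 0 ltac:(lra)) as [Hp| ->].
          - left. apply ln_increasing; lra.
          - right. f_equal. ring. }
        generalize exp_0. intros E0.
        destruct (Rle_lt_or_eq_dec (a * ln (1 + s) - a * ln (1 - s)) 0 ltac:(nra)) as [Hlt| ->]; [|lra].
        generalize (exp_increasing _ _ Hlt). lra. }
    rewrite H_primitive_0 in Hle. lra. }
  replace (- H_at_m1 a a) with L; [exact HL|].
  assert (E : H_at_m1 a a = - L); [|rewrite E; ring].
  unfold H_at_m1. apply (RInt_gen_of_limit _ (H_primitive a a)).
  - apply at_right_proper_filter.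
  - apply (locally_interval _ (-1) m_infty 0); [exact Logic.I|simpl; lra|].
    simpl. intros s _ Hs Hs1.
    apply is_derive_RInt_0; [intros; now apply continuous_H_integrand|lra].
  - assert (HLim : filterlim (fun t => - H_primitive a a (- t)) (at_left 1) (locally L)).
    { apply lub_limit_left; [|exact HL]. intros s t Hs Ht.
      apply Ropp_le_contravar, H_primitive_incr; lra. }
    apply (filterlim_locally (H_primitive a a) (- L)). intros eps.
    destruct (proj1 (filterlim_locally _ _) HLim eps) as [d Hd].
    exists d. intros s Hs Hs1.
    unfold ball in *; simpl in *. unfold AbsRing_ball, abs, minus, plus, opp in *; simpl in *.
    assert (Hs2 : Rabs (- s + - (1)) < d).
    { rewrite <- Rabs_Ropp. replace (- (- s + - (1))) with (s + - - (1)) by ring. exact Hs. }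
    specialize (Hd (- s) Hs2 ltac:(lra)). rewrite Ropp_involutive in Hd.
    rewrite <- Rabs_Ropp. replace (- (H_primitive a a s + - - L)) with (- H_primitive a a s + - L) by ring.
    exact Hd.
Qed.

(** * Harmonic mappings with bounded pre-Schwarzian norm *)

(** A single analytic function is treated as a harmonic mapping whose
    antiholomorphic part is this one. *)
Definition C_zero_fun : C -> C := fun _ => 0%C.

Lemma C_zero_fun_smooth : smooth_on_disk C_zero_fun.
Proof. intros z _. exact (expandable_const 1 0 z). Qed.

Lemma C_derive_zero_fun (z : C) : C_derive C_zero_fun z = 0.
Proof.
  apply (C_derive_of_slope C_zero_fun C_zero_fun z); [|apply continuous_Cconst].
  apply filter_forall. intros y. unfold C_zero_fun. ring.
Qed.

Lemma Cplus_conj_zero_fun (w z : C) : (w + Cconj (C_zero_fun z))%C = w.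
Proof. unfold C_zero_fun. rewrite Cconj_RtoC. ring. Qed.

Lemma growth_single (A : C -> C) (m M : R -> R) :
  smooth_on_disk A -> A 0 = 0 ->
  (forall z, Cmod z < 1 -> Cmod (C_derive A z) <= m (Cmod z)) ->
  (forall t, 0 <= t < 1 -> is_derive M t (m t)) ->
  forall z, Cmod z < 1 -> Cmod (A z) <= M (Cmod z) - M 0.
Proof.
  intros HA A0 Hm HM z Hz. rewrite <- (Cplus_conj_zero_fun (A z) z).
  apply growth with m; auto using C_zero_fun_smooth.
  intros y Hy. rewrite C_derive_zero_fun, Cmod_0, Rplus_0_r. auto.
Qed.

(** As the improper integral is the supremum of the partial ones, every [w] of the open
    disk satisfies [|w| < - c * H_primitive a a (- rho)] for some [rho < 1]. *)
Lemma harmonic_image_contains_disk (A B : C -> C) (c a : R) :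
  smooth_on_disk A -> smooth_on_disk B -> A 0 = 0 -> B 0 = 0 -> 0 <= a -> 0 < c ->
  (forall z, Cmod z < 1 ->
     c * H_integrand a a (- Cmod z) <= Cmod (C_derive A z) - Cmod (C_derive B z)) ->
  image_contains_disk (fun z => (A z + Cconj (B z))%C) (- (c * H_at_m1 a a)).
Proof.
  intros HA HB A0 B0 Ha Hc Hp w Hw.
  assert (Hrho : exists rho, 0 <= rho < 1 /\ Cmod w < c * - H_primitive a a (- rho)).
  { apply NNPP. intros Hn.
    assert (Hle : - H_at_m1 a a <= Cmod w / c).
    { apply (H_at_m1_lub a Ha). intros y [t [Ht ->]]. apply Rnot_lt_le. intros Hlt.
      apply Hn. exists t. split; [exact Ht|].
      apply Rmult_lt_compat_l with (r := c) in Hlt; [|exact Hc].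
      replace (c * (Cmod w / c)) with (Cmod w) in Hlt by (field; lra). exact Hlt. }
    apply Rmult_le_compat_l with (r := c) in Hle; [|lra].
    replace (c * (Cmod w / c)) with (Cmod w) in Hle by (field; lra). lra. }
  destruct Hrho as [rho [Hr Hwr]].
  apply (harmonic_covering A B (fun t => c * H_integrand a a (- t))
           (fun t => c * - H_primitive a a (- t))) with rho; auto.
  - rewrite Ropp_0, H_primitive_0. ring.
  - intros t Ht. apply Rmult_lt_0_compat; [exact Hc|apply H_integrand_pos].
  - intros t Ht. apply (is_derive_scal (fun t => - H_primitive a a (- t)) t c).
    evar_last.
    { apply (is_derive_opp (V := R_NormedModule)).
      apply (is_derive_comp (V := R_NormedModule) (H_primitive a a) (fun t => - t)).
      - apply is_derive_H_primitive. lra.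
      - apply (is_derive_opp (V := R_NormedModule) (fun t => t)), (is_derive_id (K := R_AbsRing)). }
    unfold opp, scal, one; simpl. unfold mult; simpl. ring.
Qed.

Theorem corollary6p1 :
  forall (lam : R) (f : harmonic_mapping),
    0 <= lam -> class_BH lam f ->
    let h := hol_part f in
    let g := antihol_part f in
    let b1 := C_derive g 0 in
    let phi := fun r : R => Rpower (1 - r) ((1 - lam) / 2) in
    (1 < lam ->
       bigO_at_circle f phi /\ bigO_at_circle h phi /\ bigO_at_circle g phi) /\
    (lam < 1 ->
       forall z : C, unit_disk z ->
         Cmod (f z)
           <= (1 + Cmod b1) * H_at_1 ((lam + 1) / 2) ((lam + 1) / 2) /\
         Cmod (h z)
           <= (1 - Cmod b1) * H_at_1 ((lam - 1) / 2) ((lam + 1) / 2)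
              + Cmod b1 * H_at_1 ((lam + 1) / 2) ((lam + 1) / 2) /\
         Cmod (g z)
           <= H_at_1 ((lam + 1) / 2) ((lam + 1) / 2)
              - (1 - Cmod b1) * H_at_1 ((lam - 1) / 2) ((lam + 1) / 2)) /\
    (0 < lam ->
       image_contains_disk h
         (- (sqrt (1 - Cmod b1 ^ 2) * H_at_m1 (lam / 2) (lam / 2)))) /\
    (class_SH f ->
       image_contains_disk f
         (- ((1 - Cmod b1) * H_at_m1 ((lam + 1) / 2) ((lam + 1) / 2)))).
Proof.
  intros lam f Hlam Hf h g b1 phi.
  generalize Hf. intros [[Hsp [h0 [Hh1 g0]]] _]. fold h g in h0, Hh1, g0.
  generalize (b1_bounds f (proj1 Hf)). fold g b1. intros Hb.
  assert (Hd : forall z, Cmod z < 1 -> distortion_data lam (Cmod b1) (Cmod z)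
            (Cmod (C_derive h z)) (Cmod (C_derive g z)))
    by (intros z Hz; exact (class_BH_distortion lam f z Hf Hz)).
  assert (Sh : smooth_on_disk h) by apply analytic_smooth, hol_part_analytic.
  assert (Sg : smooth_on_disk g) by apply analytic_smooth, antihol_part_analytic.
  set (A := (lam + 1) / 2).
  assert (HS : forall z, Cmod z < 1 -> H_integrand A A (Cmod z)
             = (1 + Cmod z) * H_integrand ((lam - 1) / 2) A (Cmod z)).
  { intros z Hz. replace (H_integrand A A (Cmod z))
      with (H_integrand ((lam - 1) / 2 + 1) A (Cmod z)) by (f_equal; unfold A; field).
    apply H_integrand_S. generalize (Cmod_ge_0 z). lra. }
  split; [|split; [|split]].
  - intros Hlam1.
    (* the factor (1 + b) * (1 + t) ^ A in the bound of |h'| + |g'| is below 2 * 2 ^ A *)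
    set (C0 := 2 * exp (A * ln 2)).
    assert (HC0 : 0 < C0) by (unfold C0; generalize (exp_pos (A * ln 2)); lra).
    set (m := fun t => C0 * exp (- A * ln (1 - t))).
    set (M := fun t => C0 * (2 / (lam - 1)) * exp ((1 - lam) / 2 * ln (1 - t))).
    assert (HM : forall t, 0 <= t < 1 -> is_derive M t (m t)).
    { intros t Ht. unfold M, m. auto_derive; [lra|].
      replace ((1 - lam) / 2 * ln (1 + - t)) with (ln (1 - t) + - A * ln (1 - t)).
      2:{ unfold A. replace (1 + - t) with (1 - t) by ring. field. }
      rewrite exp_plus, exp_ln by lra. field. lra. }
    assert (Hm : forall z, Cmod z < 1 -> Cmod (C_derive h z) + Cmod (C_derive g z) <= m (Cmod z)).
    { intros z Hz. eapply Rle_trans; [apply (derive_sum_upper _ _ _ _ _ (Hd z Hz))|].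
      assert (Hr : 0 <= Cmod z) by apply Cmod_ge_0. fold A. rewrite H_integrand_exp.
      replace (A * ln (1 + Cmod z) - A * ln (1 - Cmod z))
        with (A * ln (1 + Cmod z) + - A * ln (1 - Cmod z)) by ring.
      rewrite exp_plus. unfold m, C0.
      assert (E : exp (A * ln (1 + Cmod z)) <= exp (A * ln 2)).
      { left. apply exp_increasing, Rmult_lt_compat_l; [unfold A; lra|].
        apply ln_increasing; lra. }
      rewrite <- Rmult_assoc. apply Rmult_le_compat_r; [apply Rlt_le, exp_pos|].
      generalize (exp_pos (A * ln (1 + Cmod z))). nra. }
    assert (HMphi : forall F : C -> C,
              (forall z, Cmod z < 1 -> Cmod (F z) <= M (Cmod z) - M 0) -> bigO_at_circle F phi).
    { intros F HF. exists (C0 * (2 / (lam - 1))), 0. split; [lra|]. intros z [_ Hz].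
      eapply Rle_trans; [now apply HF|].
      assert (0 <= M 0).
      { unfold M. apply Rmult_le_pos; [|apply Rlt_le, exp_pos].
        apply Rmult_le_pos; [lra|]. apply Rdiv_le_0_compat; lra. }
      unfold phi, Rpower. unfold M at 1. lra. }
    split; [|split]; apply HMphi.
    + now apply growth with m.
    + apply growth_single with m; try assumption. intros z Hz.
      generalize (Hm z Hz) (Cmod_ge_0 (C_derive g z)). lra.
    + apply growth_single with m; try assumption. intros z Hz.
      generalize (Hm z Hz) (Cmod_ge_0 (C_derive h z)). lra.
  - intros Hlam1 z Hz.
    destruct (H_at_1_lub A A) as [S1 _]; [unfold A; lra|unfold A; lra|].
    destruct (H_at_1_lub ((lam - 1) / 2) A) as [K1 K2]; [lra|unfold A; lra|].
    assert (Hr : 0 <= Cmod z < 1) by (split; [apply Cmod_ge_0|exact Hz]).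
    assert (S1z : H_primitive A A (Cmod z) <= H_at_1 A A) by (apply S1; exists (Cmod z); auto).
    assert (K1z : H_primitive ((lam - 1) / 2) A (Cmod z) <= H_at_1 ((lam - 1) / 2) A)
      by (apply K1; exists (Cmod z); auto).
    split; [|split].
    + assert (Gf : Cmod (f z) <= (1 + Cmod b1) * H_primitive A A (Cmod z)
                     - (1 + Cmod b1) * H_primitive A A 0).
      { apply (growth h g (fun t => (1 + Cmod b1) * H_integrand A A t)
                 (fun t => (1 + Cmod b1) * H_primitive A A t)); auto.
        - intros y Hy. exact (derive_sum_upper _ _ _ _ _ (Hd y Hy)).
        - intros t Ht. apply (is_derive_scal (H_primitive A A)), is_derive_H_primitive. lra. }
      rewrite H_primitive_0 in Gf. nra.
    + assert (Gh : Cmod (h z) <=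
         ((1 - Cmod b1) * H_primitive ((lam - 1) / 2) A (Cmod z) + Cmod b1 * H_primitive A A (Cmod z))
         - ((1 - Cmod b1) * H_primitive ((lam - 1) / 2) A 0 + Cmod b1 * H_primitive A A 0)).
      { apply (growth_single h
          (fun t => (1 - Cmod b1) * H_integrand ((lam - 1) / 2) A t + Cmod b1 * H_integrand A A t)
          (fun t => (1 - Cmod b1) * H_primitive ((lam - 1) / 2) A t + Cmod b1 * H_primitive A A t)); auto.
        - intros y Hy. rewrite HS by exact Hy.
          generalize (hol_derive_upper _ _ _ _ _ (Hd y Hy)). fold A. lra.
        - intros t Ht. apply (is_derive_plus (V := R_NormedModule));
            apply is_derive_scal, is_derive_H_primitive; lra. }
      rewrite !H_primitive_0 in Gh. nra.
    + set (M := fun t => H_primitive A A t - (1 - Cmod b1) * H_primitive ((lam - 1) / 2) A t).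
      set (m := fun t => H_integrand A A t - (1 - Cmod b1) * H_integrand ((lam - 1) / 2) A t).
      assert (HM : forall t, 0 <= t < 1 -> is_derive M t (m t)).
      { intros t Ht. apply (is_derive_minus (V := R_NormedModule)).
        - apply is_derive_H_primitive. lra.
        - apply is_derive_scal, is_derive_H_primitive. lra. }
      assert (Gg : Cmod (g z) <= M (Cmod z) - M 0).
      { apply (growth_single g m M); auto. intros y Hy. unfold m. rewrite HS by exact Hy.
        generalize (antihol_derive_upper _ _ _ _ _ (Hd y Hy)). fold A. lra. }
      assert (M0 : M 0 = 0) by (unfold M; rewrite !H_primitive_0; ring).
      assert (Hmono : forall t, Cmod z <= t < 1 -> M (Cmod z) <= M t).
      { intros t Ht. apply le_of_derive_nonneg with m; [lra| |].
        - intros s Hs. apply HM. lra.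
        - intros s Hs. unfold m.
          replace (H_integrand A A s) with (H_integrand ((lam - 1) / 2 + 1) A s)
            by (f_equal; unfold A; field).
          rewrite H_integrand_S by lra.
          generalize (H_integrand_pos ((lam - 1) / 2) A s). nra. }
      (* M is nondecreasing, so that H_at_1 A A - M |z| bounds (1 - |b1|) times every value of
         the second primitive, hence also (1 - |b1|) times their supremum *)
      assert (HK : H_at_1 ((lam - 1) / 2) A <= (H_at_1 A A - M (Cmod z)) / (1 - Cmod b1)).
      { apply K2. intros y [t [Ht ->]].
        apply Rmult_le_reg_r with (1 - Cmod b1); [lra|].
        unfold Rdiv at 2. rewrite Rmult_assoc, Rinv_l, Rmult_1_r by lra.
        assert (Ht' : 0 <= Rmax t (Cmod z) < 1).
        { split; [apply Rle_trans with (2 := Rmax_l _ _); lra|]. apply Rmax_lub_lt; lra. }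
        assert (Q1 : H_primitive ((lam - 1) / 2) A t <= H_primitive ((lam - 1) / 2) A (Rmax t (Cmod z))).
        { apply H_primitive_incr; [|lra]. generalize (Rmax_l t (Cmod z)). lra. }
        assert (Q2 : M (Cmod z) <= M (Rmax t (Cmod z))).
        { apply Hmono. generalize (Rmax_r t (Cmod z)). lra. }
        assert (Q3 : H_primitive A A (Rmax t (Cmod z)) <= H_at_1 A A)
          by (apply S1; exists (Rmax t (Cmod z)); auto).
        unfold M at 2 in Q2. nra. }
      apply Rmult_le_compat_r with (r := 1 - Cmod b1) in HK; [|lra].
      unfold Rdiv at 2 in HK. rewrite Rmult_assoc, Rinv_l, Rmult_1_r in HK by lra. lra.
  - intros Hl w Hw.
    assert (Hsq : 0 < sqrt (1 - Cmod b1 ^ 2)) by (apply sqrt_lt_R0; nra).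
    destruct (harmonic_image_contains_disk h C_zero_fun (sqrt (1 - Cmod b1 ^ 2)) (lam / 2)) with (w := w)
      as [z [Hz Ez]]; auto using C_zero_fun_smooth.
    + lra.
    + intros z Hz. rewrite C_derive_zero_fun, Cmod_0, Rminus_0_r.
      exact (hol_derive_lower _ _ _ _ _ (Hd z Hz)).
    + exists z. split; [exact Hz|]. now rewrite Cplus_conj_zero_fun in Ez.
  - intros _.
    apply (harmonic_image_contains_disk h g (1 - Cmod b1) A); auto.
    + unfold A; lra.
    + lra.
    + intros z Hz. exact (derive_diff_lower _ _ _ _ _ (Hd z Hz)).
Qed.
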